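(* Let $X$ and $Y$ be multivariate regularly varying random vectors on $\mathbb{R}^d$ with identical tail index $\alpha\in(0,\infty)$, $\alpha\ne1$, and canonical spectral measures $\Psi^*_X$ and $\Psi^*_Y$. Assume that both $X$ and $Y$ satisfy the balanced tails condition. (a) Let $\alpha>1$. Suppose that $$\limsup_{t\to\infty}\frac{P\{|X^{(1)}|>t\}}{P\{|Y^{(1)}|>t\}}=1$$ and that there exists $u_0>0$ such that, with $h_u(t):=(t-u)_+$, $$\forall u\ge u_0\ \ \forall\xi\in\Sigma^d\quad E\,h_u(\xi^{\top}X)\le E\,h_u(\xi^{\top}Y).$$ Then $\Psi^*_X\preceq_{\mathcal{G}_\alpha}\Psi^*_Y$. (b) Let $\alpha<1$. Suppose that $|X^{(1)}|\preceq_{\mathrm{apl}}|Y^{(1)}|$ and $|Y^{(1)}|\preceq_{\mathrm{apl}}|X^{(1)}|$, and that there exists $u_0>0$ such that, with $f_u(t):=-\min(t,u)$, $$\forall u\ge u_0\ \ \forall\xi\in\Sigma^d\quad E\,f_u\bigl((\xi^{\top}X)_+\bigr)\le E\,f_u\bigl((\xi^{\top}Y)_+\bigr).$$ Then $\Psi^*_Y\preceq_{\mathcal{G}_\alpha}\Psi^*_X$.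
   Context: $x^{(i)}$ denotes the $i$-th component of a vector $x$; $t_+=\max(t,0)$, $t_-=\max(-t,0)$; $\|x\|_1=\sum_i|x^{(i)}|$; $\Sigma^d:=\{\xi\in[0,\infty)^d:\sum_i\xi^{(i)}=1\}$; $\mathbb{S}^d_1:=\{s\in\mathbb{R}^d:\|s\|_1=1\}$. Asymptotic portfolio loss order: for random vectors $X,Y$ in $\mathbb{R}^d$, $X\preceq_{\mathrm{apl}}Y$ means that for all $\xi\in\Sigma^d$, $\limsup_{t\to\infty}\frac{P\{\xi^{\top}X>t\}}{P\{\xi^{\top}Y\ge t\}}\le 1$, where $\frac00:=1$ (and $a/0=+\infty$ for $a>0$). For real random variables this is the case $d=1$, $\Sigma^1=\{1\}$. Multivariate regular variation: $X$ in $\mathbb{R}^d$ is multivariate regularly varying with tail index $\alpha\in(0,\infty)$ if there exist a sequence $a_n\to\infty$ and a non-zero Radon measure $\nu$ on the Borel sets of $[-\infty,\infty]^d\setminus\{0\}$ with $\nu([-\infty,\infty]^d\setminus\mathbb{R}^d)=0$ such that $n\,P(a_n^{-1}X\in\cdot)\to\nu$ vaguely, where $\nu(tA)=t^{-\alpha}\nu(A)$ for $t>0$ and Borel $A$ bounded away from $0$. The exponent measure $\nu$ is unique up to a constant factor and is normalized by $\nu(\{x:\|x\|_1>1\})=1$. Balanced tails condition for $X$: $\lim_{t\to\infty}P\{|X^{(i)}|>t\}/P\{|X^{(j)}|>t\}=1$ for all $i,j\in\{1,\dots,d\}$. (It implies $\nu(B_i)>0$ for all $i$, where $B_i:=\{x\in\mathbb{R}^d:|x^{(i)}|>1\}$.)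 Canonical spectral measure (defined when $\nu(B_i)>0$ for all $i$): let $T_\alpha(t):=t_+^{1/\alpha}-t_-^{1/\alpha}$ and $T(x):=(T_\alpha(\nu(B_1)x^{(1)}),\dots,T_\alpha(\nu(B_d)x^{(d)}))$. The canonical exponent measure is $\nu^*(A):=\nu(T(A))$ for Borel $A\subset\mathbb{R}^d\setminus\{0\}$; it satisfies $\nu^*(tA)=t^{-1}\nu^*(A)$. The canonical spectral measure $\Psi^*=\Psi^*_X$ is the finite Borel measure on $\mathbb{S}^d_1$ with $\nu^*(\{x:\|x\|_1>r,\ x/\|x\|_1\in B\})=r^{-1}\Psi^*(B)$ for all $r>0$ and Borel $B\subset\mathbb{S}^d_1$. Ordering of canonical spectral measures: for $\xi\in\mathbb{R}^d$ let $g_{\xi,\alpha}(x):=\Bigl(\sum_{i=1}^d\xi^{(i)}\bigl((x^{(i)})_+^{1/\alpha}-(x^{(i)})_-^{1/\alpha}\bigr)\Bigr)_+^{\alpha}$. For canonical spectral measures $\Psi^*,\Phi^*$ on $\mathbb{S}^d_1$, $\Psi^*\preceq_{\mathcal{G}_\alpha}\Phi^*$ means $\int g_{\xi,\alpha}\,d\Psi^*\le\int g_{\xi,\alpha}\,d\Phi^*$ for all $\xi\in\Sigma^d$. *)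

(* Defs.v *)
From HB Require Import structures.
From mathcomp Require Import all_boot all_order all_algebra.
From mathcomp Require Import all_classical all_reals all_analysis.

Set Implicit Arguments.
Unset Strict Implicit.
Unset Printing Implicit Defensive.

Import Order.TTheory GRing.Theory Num.Theory.
Import numFieldNormedType.Exports.

Local Open Scope classical_set_scope.
Local Open Scope ring_scope.

(* Row vectors over R and over \bar R carry the product topology of the library;
   these are the spaces with their Borel sigma-algebras. *)
Notation borel_rV R n := (g_sigma_algebraType (@open 'rV[R]_n)).
Notation borel_erV R n := (g_sigma_algebraType (@open 'rV[\bar R]_n)).

Section vectors.
Variables (R : realType) (n : nat).

Definition dotv (xi x : 'rV[R]_n) : R := \sum_i xi ord0 i * x ord0 i.

Definition norm1 (x : 'rV[R]_n) : R := \sum_i `|x ord0 i|.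

Definition simplex : set 'rV[R]_n :=
  [set xi | (forall i, 0 <= xi ord0 i) /\ \sum_i xi ord0 i = 1].

Definition sphere1 : set 'rV[R]_n := [set s | norm1 s = 1].

Definition emb (x : 'rV[R]_n) : 'rV[\bar R]_n := map_mx EFin x.

Definition ezero : 'rV[\bar R]_n := const_mx 0%E.

Definition escale (t : R) (x : 'rV[\bar R]_n) : 'rV[\bar R]_n :=
  map_mx (fun y => (t%:E * y)%E) x.

End vectors.

Definition pospart (R : realType) (t : R) : R := Num.max t 0.
Definition negpart (R : realType) (t : R) : R := Num.max (- t) 0.

(* p / q with 0 / 0 = 1 and a / 0 = +oo for a > 0; used for probabilities only,
   so that fine loses no information *)
Definition tail_ratio (R : realType) (p q : \bar R) : \bar R :=
  if q == 0%E then (if p == 0%E then 1%E else +oo%E)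
  else (fine p / fine q)%:E.

Section apl.
Variables (R : realType) (n : nat).
Variables (d1 d2 : measure_display).
Variables (T1 : measurableType d1) (T2 : measurableType d2).
Variables (P1 : probability T1 R) (P2 : probability T2 R).

Definition apl (X : T1 -> 'rV[R]_n) (Y : T2 -> 'rV[R]_n) : Prop :=
  forall xi : 'rV[R]_n, simplex xi ->
    (limf_esup (fun t : R => tail_ratio (P1 [set w | (t < dotv xi (X w))%R])
                                        (P2 [set w | (t <= dotv xi (Y w))%R]))
               (pinfty_nbhs R) <= 1%:E)%E.

End apl.

Definition aplR (R : realType) (d1 d2 : measure_display)
    (T1 : measurableType d1) (T2 : measurableType d2)
    (P1 : probability T1 R) (P2 : probability T2 R)
    (X : T1 -> R) (Y : T2 -> R) : Prop :=
  apl P1 P2 (fun w => const_mx (X w) : 'rV[R]_1)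
            (fun w => const_mx (Y w) : 'rV[R]_1).

Section regular_variation.
Variables (R : realType) (n : nat).

(* The functions of C_c([-oo,oo]^n \ {0}), extended by 0 at the origin. *)
Definition Cc_punctured (f : 'rV[\bar R]_n -> R) : Prop :=
  continuous f /\
  exists K : set 'rV[\bar R]_n,
    [/\ compact K, ~ K (ezero R n) & forall x, ~ K x -> f x = 0].

(* A measure on the Borel sets of [-oo,oo]^n \ {0} is encoded as a Borel measure
   on [-oo,oo]^n that does not charge the origin. *)
Definition radon_punctured (nu : {measure set (borel_erV R n) -> \bar R}) : Prop :=
  nu [set ezero R n] = 0%E /\
  forall K : set 'rV[\bar R]_n, compact K -> ~ K (ezero R n) -> (nu K < +oo)%E.

Variables (d : measure_display) (T : measurableType d) (P : probability T R).

Definition mrv_limit (alpha : R) (X : T -> 'rV[R]_n)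
    (nu : {measure set (borel_erV R n) -> \bar R}) : Prop :=
  [/\ radon_punctured nu,
      exists2 A : set (borel_erV R n), measurable A & nu A <> 0%E,
      nu (~` range (@emb R n)) = 0%E,
      exists2 a : nat -> R, a k @[k --> \oo] --> +oo &
        forall f, Cc_punctured f ->
          (k%:R%:E * \int[P]_w (f (emb ((a k)^-1 *: X w)))%:E)%E @[k --> \oo]
            --> (\int[nu]_x (f x)%:E)%E &
      forall (t : R) (A : set (borel_erV R n)), 0 < t -> measurable A ->
        ~ closure (A : set 'rV[\bar R]_n) (ezero R n) ->
        nu (escale t @` A) = ((t `^ (- alpha))%:E * nu A)%E].

Definition mrv (alpha : R) (X : T -> 'rV[R]_n) : Prop :=
  exists nu, mrv_limit alpha X nu.

Definition exponent_measure (alpha : R) (X : T -> 'rV[R]_n)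
    (nu : {measure set (borel_erV R n) -> \bar R}) : Prop :=
  mrv_limit alpha X nu /\
  nu (@emb R n @` [set x | 1 < norm1 x]) = 1%E.

Definition balanced_tails (X : T -> 'rV[R]_n) : Prop :=
  forall i j : 'I_n,
    tail_ratio (P [set w | t < `|X w ord0 i|]) (P [set w | t < `|X w ord0 j|])
      @[t --> +oo] --> 1%E.

Definition Bset (i : 'I_n) : set 'rV[R]_n := [set x | 1 < `|x ord0 i|].

Definition Talpha (alpha t : R) : R :=
  pospart t `^ alpha^-1 - negpart t `^ alpha^-1.

Definition Tmap (alpha : R) (nu : {measure set (borel_erV R n) -> \bar R})
    (x : 'rV[R]_n) : 'rV[R]_n :=
  \row_i Talpha alpha (fine (nu (@emb R n @` Bset i)) * x ord0 i).

Definition canonical_exponent (alpha : R)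
    (nu : {measure set (borel_erV R n) -> \bar R}) (A : set 'rV[R]_n) : \bar R :=
  nu (@emb R n @` (Tmap alpha nu @` A)).

(* A measure on the sphere is encoded as a Borel measure on R^n carried by it. *)
Definition canonical_spectral (alpha : R) (X : T -> 'rV[R]_n)
    (Psi : {finite_measure set (borel_rV R n) -> \bar R}) : Prop :=
  Psi (~` @sphere1 R n) = 0%E /\
  exists nu : {measure set (borel_erV R n) -> \bar R},
    [/\ exponent_measure alpha X nu,
        forall i, (0 < nu (@emb R n @` Bset i))%E &
        forall (r : R) (B : set (borel_rV R n)), 0 < r -> measurable B ->
          B `<=` @sphere1 R n ->
          canonical_exponent alpha nu
            [set x | r < norm1 x /\ B ((norm1 x)^-1 *: x)]
          = (r^-1%:E * Psi B)%E].

End regular_variation.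

Definition gfun (R : realType) (n : nat) (xi : 'rV[R]_n) (alpha : R)
    (x : 'rV[R]_n) : R :=
  pospart (\sum_i xi ord0 i * (pospart (x ord0 i) `^ alpha^-1
                               - negpart (x ord0 i) `^ alpha^-1)) `^ alpha.

Definition leG (R : realType) (n : nat) (alpha : R)
    (Psi Phi : {finite_measure set (borel_rV R n) -> \bar R}) : Prop :=
  forall xi : 'rV[R]_n, simplex xi ->
    (\int[Psi]_(x in @sphere1 R n) (gfun xi alpha x)%:E
     <= \int[Phi]_(x in @sphere1 R n) (gfun xi alpha x)%:E)%E.

Definition hfun (R : realType) (u t : R) : R := pospart (t - u).

Definition floss (R : realType) (u t : R) : R := - Num.min t u.

(* Main.v *)
Require Import Defs.
From HB Require Import structures.
From mathcomp Require Import all_boot all_order all_algebra.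
From mathcomp Require Import all_classical all_reals all_analysis.
From mathcomp Require Import measurable_realfun ring lra.

Set Implicit Arguments.
Unset Strict Implicit.
Unset Printing Implicit Defensive.

Import Order.TTheory GRing.Theory Num.Theory.
Import numFieldNormedType.Exports.
Local Open Scope classical_set_scope.
Local Open Scope ring_scope.

(* Write F(t) = P(|X_1| > t), and nu for the exponent measure of X.  Vague
   convergence along the normalizing sequence gives P(xi.X > t) / F(t) ->
   nu(xi.x > 1) / nu(B_1) and F(l t) / F(t) -> l^(-alpha); since balanced tails
   force nu(B_1) = ... = nu(B_d), the polar decomposition of the canonical
   exponent measure identifies the first limit with the integral of g_xi against
   the canonical spectral measure.  It remains to compare, for fixed xi, the
   constants c_X and c_Y in P(xi.X > t) ~ c_X F(t), P(xi.Y > t) ~ c_Y G(t).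

   For alpha > 1, splitting (v - u)_+ at l u and using regular variation shows
   that E(|X_1| - u)_+ and E(|Y_1| - u)_+ are of order u F(u) and u G(u) with the
   same constant (Karamata).  If c_X > c_Y the order of the excesses would make
   F / G eventually smaller than a constant < 1, contradicting limsup F / G = 1.

   For alpha < 1, the hypotheses give limsup F / G <= 1, so c_X < c_Y would bound
   E min(|Y_1|, u) uniformly in u, although it diverges: u G(u) stays bounded
   below along u = 2^k u_0. *)

(** * The compactification and its Borel sets *)

(** The normalizing sequences and exponent measures of X and Y are unrelated, so nothing is compared
    at that level: each vector is measured against its own first coordinate, and dividing by nu(B_1)
    is the normalization built into the canonical spectral measure. For alpha > 1 the obstacle is
    that a limsup equal to 1 yields F(u) >= (1 - d) G(u) only for some arbitrarily large u. The
    upper bound on one excess and the lower bound on the other must therefore meet at a common u,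
    with explicit constants. A single ratio l > 1 provides them: with m = l^(-alpha), the excess e
    satisfies e(l u) ~ l m e(u), so the splitting becomes a linear inequality for e(u), solvable
    because l m < 1; this is where alpha > 1 enters. Up to small errors the two bounds differ by a
    factor m, hence l is taken close to 1, after the gap between c_X and c_Y is fixed. For alpha < 1
    the mean of |Y_1| is infinite, so means are truncated at u. The inequality F <= eta G now holds
    at every large t and can be integrated; it leads to e <= C' + q e with q < 1 for e = E
    min(|Y_1|, u). *)

Lemma compact_ereal (R : realType) : compact [set: \bar R].
Proof.
have -> : [set: \bar R] = (@expand R) @` `[-1, 1]%classic.
  apply/esym/seteqP; split=> // x _; exists (contract x); last exact: contractK.
  by rewrite /= in_itv /= -ler_norml contract_le1.
apply: continuous_compact; last exact: segment_compact.
apply: continuous_subspaceT => x; apply/cvg_ballP => e e0.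
(* Balls of [\bar R] are defined through [contract], and [contract] after [expand] is the truncation
   to [-1, 1], which is 1-Lipschitz. *)
have lip (r r' : R) : `|contract (expand r) - contract (expand r')| <= `|r - r'|.
  have K z : contract (@expand R z) = Num.max (-1) (Num.min z 1).
    have [z1|z1] := leP 1 z; first by rewrite expand1//=; case: (leP (-1 : R) 1) => //; lra.
    have [zN1|zN1] := leP z (-1); first by rewrite expandN1//=; case: (leP (-1) z) => //; lra.
    by rewrite expandK ?inE ?ler_norml ?(ltW z1) ?(ltW zN1)//; case: (leP (-1) z) => //; lra.
  rewrite !K ler_norml.
  have := ler_norm (r - r'); have := ler_norm (r' - r); rewrite distrC.
  case: (leP r 1); case: (leP r' 1); case: (leP (-1) r); case: (leP (-1) r');
    case: (leP (-1 : R) 1); rewrite //; lra.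
apply: filterS (nbhsx_ballx x e e0) => y xye.
by rewrite /ball/= /ereal_ball (le_lt_trans (lip _ _))//.
Qed.

Lemma continuous_coord (T : topologicalType) (m n : nat) (i : 'I_m) (j : 'I_n) :
  continuous (fun M : 'M[T]_(m, n) => M i j).
Proof.
move=> M A /= MA; exists (fun i' j' => if (i' == i) && (j' == j) then A else setT).
  move=> i' j'; case: ifP => [/andP[/eqP -> /eqP ->]//|_]; apply: filterT.
by move=> N /= /(_ i j); rewrite !eqxx.
Qed.

Lemma compact_erV (R : realType) (n : nat) : compact [set: 'rV[\bar R]_n].
Proof.
have -> : [set: 'rV[\bar R]_n] = [set v | forall i, [set: \bar R] (v ord0 i)].
  by apply/seteqP; split.
by apply: (@rV_compact (\bar R) n (fun=> setT)) => _; exact: compact_ereal.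
Qed.

Section emb.
Variables (R : realType) (n : nat).
Implicit Types (A : set 'rV[R]_n).

Lemma emb_inj : injective (@emb R n).
Proof.
by move=> x y /matrixP xy; apply/matrixP => i j; have := xy i j; rewrite !mxE => -[].
Qed.

Lemma open_emb A : open A -> open (@emb R n @` A).
Proof.
rewrite !openE => Ao _ [x Ax <-]; have [P Px PA] := Ao x Ax.
exists (fun i j => EFin @` P i j).
  move=> i j; rewrite mxE; apply/nbhs_EFin; apply: filterS (Px i j) => y Py.
  by exists y.
move=> z zP; exists (map_mx fine z).
  by apply: PA => i j; have [y Py yz] := zP i j; rewrite mxE -yz.
apply/matrixP => i j; rewrite !mxE.
by have [y Py <-] := zP i j.
Qed.

Lemma measurable_open (T : ptopologicalType) (A : set T) :
  open A -> measurable (A : set (g_sigma_algebraType (@open T))).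
Proof. by move=> Ao; apply: sub_sigma_algebra. Qed.

(** Every mass below is taken of an image under [emb], so images of Borel sets must be Borel. The
    sets with this property form a sigma-algebra: complements are taken inside the open set
    [range emb], by injectivity. *)
Lemma measurable_emb (A : set (borel_rV R n)) :
  measurable A -> measurable (@emb R n @` A : set (borel_erV R n)).
Proof.
have mr : measurable (range (@emb R n) : set (borel_erV R n)).
  by apply: measurable_open; apply: open_emb; exact: openT.
suff : <<s @open 'rV[R]_n >> `<=`
    [set A | measurable (@emb R n @` A : set (borel_erV R n))] by apply.
apply: smallest_sub; last by move=> B /open_emb; exact: measurable_open.
split=> [|B mB|F mF] /=.
- by rewrite image_set0.
- have -> : [set emb x | x in setT `\` B] = range (@emb R n) `\` (@emb R n @` B).
    apply/seteqP; split=> [_ [x [_ nBx] <-]|_ [[x _ <-] nBx]].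
      by split; [exists x | move=> [y By /emb_inj yx]; apply: nBx; rewrite -yx].
    by exists x => //; split=> // Bx; apply: nBx; exists x.
  exact: measurableD.
- by rewrite image_bigcup; apply: bigcupT_measurable => k; exact: mF.
Qed.

End emb.

Lemma continuous_measurable_borelR (R : realType) (T : ptopologicalType)
    (f : T -> R) : continuous f ->
  measurable_fun setT (f : g_sigma_algebraType (@open T) -> R).
Proof.
move=> cf; apply: (measurability _ (RGenOpens.measurableE R)).
move=> _ [_ [x [y ->]] <-]; rewrite setTI; apply: measurable_open.
by apply: open_comp; [move=> z _; exact: cf|exact: interval_open].
Qed.

(* The scalar product does not extend continuously to [-oo,oo]^n; test functions
   are built on clamped coordinates instead. *)
Definition clamp (R : realType) (M : R) (y : \bar R) : R :=
  match y with
  | r%:E => Num.max (- M) (Num.min r M)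
  | +oo%E => M
  | -oo%E => - M
  end.

Lemma continuous_clamp (R : realType) (M : R) : 0 < M -> continuous (clamp M).
Proof.
move=> M0 [r| |] A /= MA.
- apply/nbhs_EFin => /=.
  suff : (fun s : R => Num.max (- M) (Num.min s M)) @ r --> Num.max (- M) (Num.min r M).
    by apply.
  apply: (@continuous_max _ _ (fun=> - M) (fun s => Num.min s M)); first exact: cst_continuous.
  by apply: (@continuous_min _ _ id (fun=> M)); [move=> ?|exact: cst_continuous].
- apply: filterS (ereal_nbhs_pinfty_gt (num_real M)) => -[s| |]//=.
    rewrite lte_fin => sM; rewrite min_r ?max_r ?ltW//; last lra.
    exact: nbhs_singleton.
  by move=> _; exact: nbhs_singleton.
- apply: filterS (ereal_nbhs_ninfty_lt (num_real (- M))) => -[s| |]//=.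
    rewrite lte_fin => sM; rewrite min_l ?max_l ?ltW//; last lra.
    exact: nbhs_singleton.
  by move=> _; exact: nbhs_singleton.
Qed.

(** * Test functions on the punctured space *)

Lemma continuous_emb (R : realType) (n : nat) : continuous (@emb R n).
Proof.
move=> x A /= [P Px PA]; exists (fun i j => EFin @^-1` P i j).
  by move=> i j; apply/nbhs_EFin; have := Px i j; rewrite mxE.
by move=> y yP; apply: PA => i j; rewrite mxE; exact: yP.
Qed.

Section punctured.
Variables (R : realType) (n : nat).

(** The complement of an open box around the origin. Being closed in a compact space it is compact,
    so it serves both as a support of test functions and as a set of finite mass. *)
Definition away (delta : R) : set 'rV[\bar R]_n :=
  [set x | exists i, (delta%:E <= `|x ord0 i|)%E].

Lemma open_setC_away delta : open (~` away delta).
Proof.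
rewrite openE => x xK.
exists (fun i j => [set y | (`|y| < delta%:E)%E]); last first.
  by move=> y yP [i]; rewrite leNgt yP.
move=> i j; rewrite [i]ord1 /=.
have : (`|x ord0 j| < delta%:E)%E by rewrite ltNge; apply/negP => h; apply: xK; exists j.
case: (x ord0 j) => [r| |]//=; rewrite lte_fin => rd.
apply/nbhs_EFin => /=.
exact: (@cvgr_norm_lt _ _ _ _ (nbhs_filter r) id r).
Qed.

Lemma compact_away delta : compact (away delta).
Proof.
apply: (@subclosed_compact _ _ setT); [|exact: compact_erV|by []].
by rewrite -openC; exact: open_setC_away.
Qed.

Lemma away0 delta : 0 < delta -> ~ away delta (ezero R n).
Proof. by move=> d0 [i]; rewrite mxE abse0 lee_fin leNgt d0. Qed.

Lemma Cc_punctured_away (f : 'rV[\bar R]_n -> R) (delta : R) : 0 < delta ->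
  continuous f -> (forall x, ~ away delta x -> f x = 0) -> Cc_punctured f.
Proof.
move=> d0 cf f0; split=> //; exists (away delta); split=> //.
  exact: compact_away.
exact: away0.
Qed.

End punctured.

Section test_functions.
Variables (R : realType) (n : nat).
Implicit Types (xi x : 'rV[R]_n) (y : 'rV[\bar R]_n) (M a b : R).

Definition ramp a b (t : R) : R := Num.max 0 (Num.min 1 ((t - a) / (b - a))).

Lemma ramp_ge0 a b t : 0 <= ramp a b t.
Proof. by rewrite le_max lexx. Qed.

Lemma ramp_le1 a b t : ramp a b t <= 1.
Proof. by rewrite ge_max ler01 ge_min lexx. Qed.

Lemma ramp0 a b t : a < b -> t <= a -> ramp a b t = 0.
Proof.
move=> ab ta; apply/max_idPl; rewrite ge_min; apply/orP; right.
by rewrite pmulr_lle0 ?invr_gt0; lra.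
Qed.

Lemma ramp1 a b t : a < b -> b <= t -> ramp a b t = 1.
Proof.
move=> ab bt; rewrite /ramp min_l ?max_r// ler_pdivlMr; lra.
Qed.

Lemma continuous_ramp a b : continuous (ramp a b).
Proof.
move=> t.
apply: (@continuous_max R _ (fun=> 0) (fun t => Num.min 1 ((t - a) / (b - a)))).
  exact: cst_continuous.
apply: (@continuous_min R _ (fun=> 1) (fun t => (t - a) / (b - a))).
  exact: cst_continuous.
by apply: cvgM; [apply: cvgB; [exact: cvg_id|exact: cvg_cst]|exact: cvg_cst].
Qed.

Lemma continuous_sum (T : topologicalType) (I : finType) (f : I -> T -> R) :
  (forall i, continuous (f i)) -> continuous (fun z => \sum_i f i z).
Proof. by move=> cf z; apply: cvg_big => [|i _]; [exact: add_continuous|exact: cf]. Qed.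

Lemma continuous_clamp_coord M (i : 'I_n) : 0 < M ->
  continuous (fun y : 'rV[\bar R]_n => clamp M (y ord0 i)).
Proof.
move=> M0 y.
apply: (@continuous_comp _ _ _ (fun y : 'rV[\bar R]_n => y ord0 i) (clamp M)).
  exact: continuous_coord.
exact: continuous_clamp.
Qed.

Definition clamped_dot M xi y : R := \sum_i xi ord0 i * clamp M (y ord0 i).

Definition clamped_norm M y : R := \sum_i `|clamp M (y ord0 i)|.

Lemma continuous_clamped_dot M xi : 0 < M -> continuous (clamped_dot M xi).
Proof.
move=> M0; apply: continuous_sum => i y.
by apply: (cvgM (cvg_cst (xi ord0 i)) (@continuous_clamp_coord M i M0 y)).
Qed.

Lemma continuous_clamped_norm M : 0 < M -> continuous (clamped_norm M).
Proof.
move=> M0; apply: continuous_sum => i y.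
by apply: (cvg_norm (@continuous_clamp_coord M i M0 y)).
Qed.

Lemma continuous_ramp_dot M xi a b : 0 < M ->
  continuous (fun y => ramp a b (clamped_dot M xi y)).
Proof.
move=> M0 y; apply: (@continuous_comp _ _ _ (clamped_dot M xi) (ramp a b)).
  exact: continuous_clamped_dot.
exact: continuous_ramp.
Qed.

Lemma continuous_ramp_norm M a b : 0 < M ->
  continuous (fun y => ramp a b (clamped_norm M y)).
Proof.
move=> M0 y; apply: (@continuous_comp _ _ _ (clamped_norm M) (ramp a b)).
  exact: continuous_clamped_norm.
exact: continuous_ramp.
Qed.

Lemma clamped_dot_emb M xi x : norm1 x <= M -> clamped_dot M xi (emb x) = dotv xi x.
Proof.
move=> xM; apply: eq_bigr => i _; rewrite mxE /=; congr (_ * _).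
have : `|x ord0 i| <= M.
  by rewrite (le_trans _ xM)// /norm1 (bigD1 i)//= lerDl sumr_ge0.
by rewrite ler_norml => /andP[h1 h2]; rewrite min_l// max_r.
Qed.

Lemma clamp_norm_le M (r : R) : 0 <= M -> `|clamp M r%:E| <= `|r|.
Proof.
move=> M0; rewrite /= ler_norml; have := ler_norm r; have := ler_norm (- r).
rewrite normrN; case: (leP r M) => rM; first by case: (leP (- M) r) => h; lra.
by case: (leP (- M) M) => h; lra.
Qed.

Lemma clamped_norm_le M x : 0 <= M -> clamped_norm M (emb x) <= norm1 x.
Proof. by move=> M0; apply: ler_sum => i _; rewrite mxE clamp_norm_le. Qed.

Lemma clamped_norm_ge M x : 0 <= M -> M < norm1 x -> M <= clamped_norm M (emb x).
Proof.
move=> M0 Mx; rewrite leNgt; apply/negP => h.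
(* Were the clamped norm below [M], every clamped coordinate would be too, so that no coordinate
   would have been changed by clamping. *)
suff e : clamped_norm M (emb x) = norm1 x by rewrite e in h; lra.
apply: eq_bigr => i _; rewrite mxE /=.
have : `|clamp M (x ord0 i)%:E| < M.
  rewrite (le_lt_trans _ h)// /clamped_norm (bigD1 i)//= mxE lerDl sumr_ge0//.
rewrite /= ltr_norml => /andP[].
case: (leP (x ord0 i) M) => h1; first by case: (leP (- M) (x ord0 i)) => // h2; lra.
by case: (leP (- M) M) => // h2; lra.
Qed.

Lemma clamp_away M delta y i : 0 < delta <= M -> ~ away delta y ->
  `|clamp M (y ord0 i)| <= delta.
Proof.
move=> /andP[d0 dM] yd.
have : (`|y ord0 i| < delta%:E)%E by rewrite ltNge; apply/negP => h; apply: yd; exists i.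
case: (y ord0 i) => [r| |]//; rewrite lte_fin => h.
by rewrite (le_trans (clamp_norm_le _ _)) ?ltW//; lra.
Qed.

Lemma clamped_norm_away M delta y : 0 < delta <= M -> ~ away delta y ->
  clamped_norm M y <= n%:R * delta.
Proof.
move=> dM yd; rewrite (le_trans (ler_sum _ (fun i _ => clamp_away i dM yd)))//.
by rewrite sumr_const card_ord mulr_natl.
Qed.

Lemma clamped_dot_away M xi delta y : 0 < delta <= M -> ~ away delta y ->
  clamped_dot M xi y <= norm1 xi * delta.
Proof.
move=> dM yd; rewrite /norm1 mulr_suml; apply: ler_sum => i _.
rewrite (le_trans (ler_norm _))// normrM ler_wpM2l//.
exact: clamp_away dM yd.
Qed.

Lemma ramp_away M xi s a b : 0 < M -> 0 < s -> s < a -> M / 2 < b ->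
  exists2 delta, 0 < delta & forall y, ~ away delta y ->
   ramp s a (clamped_dot M xi y) = 0 /\ ramp (M / 2) b (clamped_norm M y) = 0.
Proof.
move=> M0 s0 sa Mb; have x0 : 0 <= norm1 xi by exact: sumr_ge0.
have n0 : 0 <= n%:R :> R by [].
(* Both clamped quantities are at most a constant times [delta] off [away delta]; the [+ 1] keep the
   divisors positive when [xi = 0] or [n = 0]. *)
pose delta := Num.min M (Num.min (s / (norm1 xi + 1)) (M / 2 / (n%:R + 1))).
have d0 : 0 < delta by rewrite !lt_min M0 !divr_gt0//; lra.
have dM : 0 < delta <= M by rewrite d0 ge_min lexx.
have ds : (norm1 xi + 1) * delta <= s.
  by rewrite mulrC -ler_pdivlMr; [rewrite !ge_min lexx orbT|lra].
have dn : (n%:R + 1) * delta <= M / 2.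
  by rewrite mulrC -ler_pdivlMr; [rewrite !ge_min lexx !orbT|lra].
exists delta => // y yd; split.
  by apply: ramp0 => //; rewrite (le_trans (clamped_dot_away _ dM yd))//; lra.
by apply: ramp0 => //; rewrite (le_trans (clamped_norm_away dM yd))//; lra.
Qed.

End test_functions.

(** * Tails along the normalizing sequence *)

Section vectors.
Variables (R : realType) (n : nat).
Implicit Types (xi x : 'rV[R]_n).

Lemma dotvZr xi (t : R) x : dotv xi (t *: x) = t * dotv xi x.
Proof. by rewrite /dotv mulr_sumr; apply: eq_bigr => i _; rewrite mxE mulrCA. Qed.

Lemma norm1Z (t : R) x : norm1 (t *: x) = `|t| * norm1 x.
Proof. by rewrite /norm1 mulr_sumr; apply: eq_bigr => i _; rewrite mxE normrM. Qed.

Lemma norm1_ge0 x : 0 <= norm1 x.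
Proof. exact: sumr_ge0. Qed.

Lemma continuous_dotv xi : continuous (dotv xi).
Proof.
apply: continuous_sum => i x.
by apply: (cvgM (cvg_cst (xi ord0 i)) (@continuous_coord _ _ _ ord0 i x)).
Qed.

Lemma continuous_norm1 : continuous (@norm1 R n).
Proof.
by apply: continuous_sum => i x; apply: (cvg_norm (@continuous_coord _ _ _ ord0 i x)).
Qed.

Lemma measurable_gt (f : 'rV[R]_n -> R) (s : R) : continuous f ->
  measurable ([set x | s < f x] : set (borel_rV R n)).
Proof.
move=> cf; rewrite -[X in measurable X]setTI.
have -> : [set x | s < f x] = f @^-1` `]s, +oo[%classic.
  by apply/seteqP; split=> x /=; rewrite in_itv/= andbT.
by apply: (continuous_measurable_borelR cf) => //; exact: measurable_itv.
Qed.

End vectors.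

Lemma ge0_integralD_indic d (T : measurableType d) (R : realType)
    (mu : {measure set T -> \bar R}) (f : T -> R) (k : R) (B : set T) :
  measurable_fun setT f -> (forall x, 0 <= f x) -> 0 <= k -> measurable B ->
  (\int[mu]_x (f x + k * \1_B x)%:E = \int[mu]_x (f x)%:E + k%:E * mu B)%E.
Proof.
move=> mf f0 k0 mB.
have mi : measurable_fun setT (EFin \o (\1_B : T -> R)).
  by apply/measurable_EFinP; exact: measurable_indic.
have i0 (x : T) : setT x -> (0 <= (EFin \o (\1_B : T -> R)) x)%E.
  by move=> _; rewrite lee_fin.
rewrite -{2}(setIT B) -(integral_indic mu measurableT mB).
rewrite -[in RHS](ge0_integralZl mu measurableT mi i0); last by rewrite lee_fin.
rewrite -(ge0_integralD mu measurableT)//.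
- by move=> x _; rewrite lee_fin.
- exact/measurable_EFinP.
- by move=> x _; apply: mule_ge0; rewrite ?i0 ?lee_fin.
- exact: measurable_funeM.
Qed.

Section limit_measure.
Variables (R : realType) (n : nat) (d : measure_display) (T : measurableType d).
Variables (P : probability T R) (X : T -> 'rV[R]_n) (alpha : R).
Variable nu : {measure set (borel_erV R n) -> \bar R}.
Hypothesis mrvX : mrv_limit P alpha X nu.

Lemma mrv_limit_fin (A : set 'rV[R]_n) (delta : R) : 0 < delta ->
  measurable (A : set (borel_rV R n)) ->
  (forall x, A x -> exists i, delta <= `|x ord0 i|) ->
  (nu (@emb R n @` A) < +oo)%E.
Proof.
move=> d0 mA Ad; have [[_ fin] _ _ _ _] := mrvX.
have := fin (away delta) (@compact_away _ _ _) (@away0 _ _ _ d0).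
apply: le_lt_trans; apply: le_measure; rewrite ?inE.
- exact: measurable_emb.
- rewrite -[away delta]setCK; apply: measurableC; apply: measurable_open.
  exact: open_setC_away.
- by move=> _ [x /Ad[i xi] <-]; exists i; rewrite mxE abse_EFin lee_fin.
Qed.

Lemma mrv_limit_scale (A : set 'rV[R]_n) (delta t : R) : 0 < delta -> 0 < t ->
  measurable (A : set (borel_rV R n)) ->
  (forall x, A x -> exists i, delta <= `|x ord0 i|) ->
  nu (@emb R n @` [set x | A (t^-1 *: x)]) = ((t `^ (- alpha))%:E * nu (@emb R n @` A))%E.
Proof.
move=> d0 t0 mA Ad; have [_ _ _ _ sc] := mrvX.
rewrite -sc//; last 2 first.
- exact: measurable_emb.
- move=> /(_ (~` away delta)) [].
    by apply: open_nbhs_nbhs; split; [exact: open_setC_away|exact: away0].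
  move=> _ [[x /Ad[i xi] <-]]; apply; exists i.
  by rewrite mxE abse_EFin lee_fin.
congr (nu _); apply/seteqP; split=> [_ [x /= Ax <-]|_ [_ [x Ax <-] <-]].
- exists (emb (t^-1 *: x)); first by exists (t^-1 *: x).
  apply/matrixP => i j; rewrite !mxE -EFinM mulrA divff ?mul1r//.
  by rewrite gt_eqF.
- exists (t *: x) => /=; first by rewrite scalerA mulVf ?scale1r// gt_eqF.
  by apply/matrixP => i j; rewrite !mxE EFinM.
Qed.

(** Points with an infinite coordinate form a null set, so inequalities between test functions and
    indicators have to be checked on finite vectors only. *)
Lemma mrv_limit_ae (Q : set 'rV[\bar R]_n) :
  (forall x, Q (emb x)) -> {ae nu, forall y, Q y}.
Proof.
move=> Qe; have [_ _ n0 _ _] := mrvX.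
exists (~` range (@emb R n)); split=> //.
  apply: measurableC; apply: measurable_open; apply: open_emb; exact: openT.
by move=> y nQ [x _ xy]; apply: nQ; rewrite -xy.
Qed.

Lemma indic_emb (A : set 'rV[R]_n) x : \1_(@emb R n @` A) (emb x) = \1_A x :> R.
Proof.
rewrite !indicE; congr (nat_of_bool _)%:R; apply/idP/idP; rewrite !inE.
  by move=> [y Ay /emb_inj <-].
by move=> Ax; exists x.
Qed.

Section bounds.
Variables (f : 'rV[\bar R]_n -> R) (A B : set 'rV[R]_n).
Hypotheses (cf : continuous f) (f0 : forall y, 0 <= f y).
Hypotheses (mA : measurable (A : set (borel_rV R n))).
Hypotheses (mB : measurable (B : set (borel_rV R n))).

Let mf : measurable_fun setT (f : borel_erV R n -> R).
Proof. exact: continuous_measurable_borelR. Qed.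

Let mind (C : set 'rV[R]_n) : measurable (C : set (borel_rV R n)) ->
  measurable_fun setT (\1_(@emb R n @` C) : borel_erV R n -> R).
Proof. by move=> mC; apply: measurable_indic; exact: measurable_emb. Qed.

(** In the applications [B] is the region of large norm, where clamping may alter the functional;
    the factor 2 bounds the sum of two ramps there. *)
Lemma mrv_limit_integral_le :
  (forall x, f (emb x) <= \1_A x + 2 * \1_B x) ->
  (\int[nu]_y (f y)%:E <= nu (@emb R n @` A) + 2%:E * nu (@emb R n @` B))%E.
Proof.
move=> fAB; rewrite -[in leRHS](setIT (@emb R n @` A)).
rewrite -(integral_indic nu measurableT (measurable_emb mA)).
rewrite -ge0_integralD_indic//; [|exact: mind|exact: measurable_emb].
apply: ae_ge0_le_integral; first exact: measurableT.
- by move=> y _; rewrite lee_fin.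
- exact/measurable_EFinP.
- by move=> y _; rewrite lee_fin addr_ge0// mulr_ge0.
- apply/measurable_EFinP; apply: measurable_funD; first exact: mind.
  by apply: measurable_funM; [exact: measurable_cst|exact: mind].
- by apply: mrv_limit_ae => x _; rewrite !indic_emb lee_fin.
Qed.

Lemma mrv_limit_integral_ge :
  (forall x, \1_A x <= f (emb x) + 2 * \1_B x) ->
  (nu (@emb R n @` A) <= \int[nu]_y (f y)%:E + 2%:E * nu (@emb R n @` B))%E.
Proof.
move=> fAB; rewrite -[in leLHS](setIT (@emb R n @` A)).
rewrite -(integral_indic nu measurableT (measurable_emb mA)).
rewrite -ge0_integralD_indic//; last exact: measurable_emb.
apply: ae_ge0_le_integral; first exact: measurableT.
- by move=> y _; rewrite lee_fin.
- by apply/measurable_EFinP; exact: mind.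
- by move=> y _; rewrite lee_fin addr_ge0// mulr_ge0.
- apply/measurable_EFinP; apply: measurable_funD => //.
  by apply: measurable_funM; [exact: measurable_cst|exact: mind].
- by apply: mrv_limit_ae => x _; rewrite !indic_emb lee_fin.
Qed.

End bounds.
End limit_measure.

Lemma continuous_scale (R : realType) (n : nat) (t : R) :
  continuous (fun x : 'rV[R]_n => t *: x).
Proof.
move=> x A /= [Q Qx QA]; exists (fun i j => (fun y => t * y) @^-1` Q i j).
  move=> i j; have := Qx i j; rewrite mxE.
  exact: (cvgM (cvg_cst t) (@cvg_id _ (nbhs (x i j)))).
by move=> y yQ; apply: QA => i j; rewrite mxE; exact: yQ.
Qed.

Lemma indic_in (R : pzRingType) (T : Type) (A : set T) x : A x -> \1_A x = 1 :> R.
Proof. by move=> Ax; rewrite indicE mem_set. Qed.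

Lemma indic_notin (R : pzRingType) (T : Type) (A : set T) x : ~ A x -> \1_A x = 0 :> R.
Proof. by move=> Ax; rewrite indicE memNset. Qed.

Section away_bounds.
Variables (R : realType) (n : nat).
Implicit Types (xi x : 'rV[R]_n).

Lemma dotv_away xi (s : R) x : 0 < s -> s < dotv xi x ->
  exists i, s / (norm1 xi + 1) <= `|x ord0 i|.
Proof.
move=> s0 sx; apply: contrapT => /forallNP h.
have n0 := norm1_ge0 xi.
have : dotv xi x <= norm1 xi * (s / (norm1 xi + 1)).
  rewrite /norm1 mulr_suml; apply: ler_sum => i _.
  rewrite (le_trans (ler_norm _))// normrM ler_wpM2l//.
  by have /negP := h i; rewrite -ltNge => /ltW.
rewrite mulrA ler_pdivlMr; last lra.
by apply/negP; rewrite -ltNge; nra.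
Qed.

Lemma norm1_away (s : R) x : 0 < s -> s < norm1 x ->
  exists i, s / (n%:R + 1) <= `|x ord0 i|.
Proof.
move=> s0 sx; apply: contrapT => /forallNP h.
have n0 : 0 <= n%:R :> R by [].
have : norm1 x <= n%:R * (s / (n%:R + 1)).
  rewrite mulr_natl -[X in _ *+ X]card_ord -sumr_const; apply: ler_sum => i _.
  by have /negP := h i; rewrite -ltNge => /ltW.
rewrite mulrA ler_pdivlMr; last lra.
by apply/negP; rewrite -ltNge; nra.
Qed.

End away_bounds.

Definition halfspace (R : realType) (n : nat) (xi : 'rV[R]_n) (s : R) :
  set 'rV[R]_n := [set x | s < dotv xi x].

Section tails.
Variables (R : realType) (n : nat) (d : measure_display) (T : measurableType d).
Variables (P : probability T R) (X : T -> 'rV[R]_n) (alpha : R).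
Variable nu : {measure set (borel_erV R n) -> \bar R}.
Hypothesis nuX : exponent_measure P alpha X nu.
Hypothesis mX : measurable_fun setT (X : T -> borel_rV R n).

Let mrvX : mrv_limit P alpha X nu. Proof. by case: nuX. Qed.

Definition half_mass (xi : 'rV[R]_n) : R := fine (nu (@emb R n @` halfspace xi 1)).

Lemma measurable_halfspace (xi : 'rV[R]_n) s :
  measurable (halfspace xi s : set (borel_rV R n)).
Proof. by apply: measurable_gt; exact: continuous_dotv. Qed.

Lemma measurable_norm1_gt s : measurable ([set x | s < norm1 x] : set (borel_rV R n)).
Proof. by apply: measurable_gt; exact: continuous_norm1. Qed.

Lemma half_massE (xi : 'rV[R]_n) (s : R) : 0 < s ->
  nu (@emb R n @` halfspace xi s) = (s `^ (- alpha) * half_mass xi)%:E.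
Proof.
move=> s0; have n0 := norm1_ge0 xi.
have d0 : 0 < 1 / (norm1 xi + 1) by rewrite divr_gt0//; lra.
have ha x : halfspace xi 1 x -> exists i, 1 / (norm1 xi + 1) <= `|x ord0 i|.
  exact: dotv_away.
have -> : halfspace xi s = [set x | halfspace xi 1 (s^-1 *: x)].
  by apply/seteqP; split=> x; rewrite /halfspace/= dotvZr ltr_pdivlMl ?mulr1.
rewrite (mrv_limit_scale mrvX d0 s0 (measurable_halfspace xi 1) ha).
rewrite EFinM /half_mass fineK// ge0_fin_numE//.
exact: (mrv_limit_fin mrvX d0 (measurable_halfspace xi 1) ha).
Qed.

Lemma half_mass_ge0 xi : 0 <= half_mass xi.
Proof. by rewrite fine_ge0. Qed.

Lemma norm1_massE (s : R) : 0 < s ->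
  nu (@emb R n @` [set x | s < norm1 x]) = (s `^ (- alpha))%:E.
Proof.
move=> s0; have n0 : 0 <= n%:R :> R by [].
have d0 : 0 < 1 / (n%:R + 1) :> R by rewrite divr_gt0//; lra.
have ha (x : 'rV[R]_n) : 1 < norm1 x -> exists i, 1 / (n%:R + 1) <= `|x ord0 i|.
  exact: norm1_away.
have -> : [set x : 'rV[R]_n | s < norm1 x] = [set x | 1 < norm1 (s^-1 *: x)].
  apply/seteqP; split=> x; rewrite /= norm1Z ger0_norm ?invr_ge0 ?ltW//.
    by rewrite ltr_pdivlMl ?mulr1.
  by rewrite ltr_pdivlMl ?mulr1.
rewrite (mrv_limit_scale mrvX d0 s0 (measurable_norm1_gt 1) ha).
by case: nuX => _ ->; rewrite mule1.
Qed.

(* A linear functional and its clamped version differ only where norm1 exceeds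
   [M]; the second ramp absorbs that error, which costs [(M / 2) ^ -alpha]. *)
Section bounds.
Variables (a : nat -> R) (aoo : a k @[k --> \oo] --> +oo).
Hypothesis acvg : forall f : 'rV[\bar R]_n -> R, Cc_punctured f ->
  (k%:R%:E * \int[P]_w (f (emb ((a k)^-1 *: X w)))%:E)%E @[k --> \oo]
    --> (\int[nu]_x (f x)%:E)%E.
Variable xi : 'rV[R]_n.

Let p (t : R) : R := fine (P [set w | t < dotv xi (X w)]).

Let mp t : measurable [set w | t < dotv xi (X w)].
Proof.
rewrite -[X in measurable X]setTI.
exact: (mX measurableT (measurable_halfspace xi t)).
Qed.

Let pE t : P [set w | t < dotv xi (X w)] = (p t)%:E.
Proof. by rewrite /p fineK// fin_num_measure. Qed.

Let mf (f : 'rV[\bar R]_n -> R) (k : nat) : continuous f ->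
  measurable_fun setT (fun w => (f (emb ((a k)^-1 *: X w)))%:E).
Proof.
move=> cf; apply/measurable_EFinP.
apply: (@measurableT_comp _ _ _ _ (borel_rV R n) _
  (fun x : 'rV[R]_n => f (emb ((a k)^-1 *: x))) _ X) => //.
apply: continuous_measurable_borelR => x.
apply: (@continuous_comp _ _ _ (fun x : 'rV[R]_n => emb ((a k)^-1 *: x)) f); last exact: cf.
apply: (@continuous_comp _ _ _ (fun x : 'rV[R]_n => (a k)^-1 *: x) (@emb R n)).
  exact: continuous_scale.
exact: continuous_emb.
Qed.

Let gtE s k w : 0 < a k -> (s < dotv xi ((a k)^-1 *: X w)) = (a k * s < dotv xi (X w)).
Proof. by move=> a0; rewrite dotvZr ltr_pdivlMl. Qed.

Let integral_ge (f : 'rV[\bar R]_n -> R) s k : continuous f ->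
  (forall y, 0 <= f y) -> 0 < a k ->
  (forall x, \1_(halfspace xi s) x <= f (emb x)) ->
  (((k%:R * p (a k * s))%:E) <=
   k%:R%:E * \int[P]_w (f (emb ((a k)^-1 *: X w)))%:E)%E.
Proof.
move=> cf f0 ak hf; rewrite EFinM; apply: lee_wpmul2l; first by rewrite lee_fin.
rewrite -pE -[X in P X]setIT -(integral_indic P measurableT (mp _)).
apply: ge0_le_integral; first exact: measurableT.
- by move=> w _; rewrite lee_fin.
- by apply/measurable_EFinP; exact: measurable_indic.
- exact: mf.
- move=> w _; rewrite lee_fin; apply: le_trans (hf _).
  have [h|h] := leP (dotv xi (X w)) (a k * s).
    by rewrite indic_notin//= ltNge h.
  by rewrite !indic_in// /halfspace/= gtE.
Qed.

Let integral_le (f : 'rV[\bar R]_n -> R) s k : continuous f ->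
  (forall y, 0 <= f y) -> 0 < a k ->
  (forall x, f (emb x) <= \1_(halfspace xi s) x) ->
  (k%:R%:E * \int[P]_w (f (emb ((a k)^-1 *: X w)))%:E
     <= ((k%:R * p (a k * s))%:E))%E.
Proof.
move=> cf f0 ak hf; rewrite EFinM; apply: lee_wpmul2l; first by rewrite lee_fin.
rewrite -pE -[X in P X]setIT -(integral_indic P measurableT (mp _)).
apply: ge0_le_integral; first exact: measurableT.
- by move=> w _; rewrite lee_fin.
- exact: mf.
- by apply/measurable_EFinP; exact: measurable_indic.
- move=> w _; rewrite lee_fin; apply: (le_trans (hf _)).
  have [h|h] := leP (dotv xi (X w)) (a k * s).
    by rewrite indic_notin// /halfspace/= gtE// ltNge h.
  by rewrite !indic_in// /halfspace/= gtE.
Qed.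

Lemma tail_ub (s s' M eta : R) : 0 < s' < s -> 0 < M ->
  s' `^ (- alpha) * half_mass xi + 2 * (M / 2) `^ (- alpha) < eta ->
  \forall k \near \oo, k%:R * p (a k * s) <= eta.
Proof.
move=> /andP[s'0 s's] M0 eta_gt.
pose f y := ramp s' s (clamped_dot M xi y) + ramp (M / 2) M (clamped_norm M y).
have M2 : M / 2 < M by lra.
have cf : continuous f.
  move=> y; exact: (cvgD (@continuous_ramp_dot _ _ _ xi s' s M0 y)
    (@continuous_ramp_norm _ _ _ (M / 2) M M0 y)).
have f0 y : 0 <= f y by rewrite addr_ge0// ramp_ge0.
have [delta d0 fd] := ramp_away xi M0 s'0 s's M2.
have Cf : Cc_punctured f.
  by apply: (Cc_punctured_away d0) => // y /fd[f1 f2]; rewrite /f f1 f2 addr0.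
have If : (\int[nu]_y (f y)%:E < eta%:E)%E.
  apply: (le_lt_trans (mrv_limit_integral_le mrvX cf f0
    (measurable_halfspace xi s') (measurable_norm1_gt (M / 2)) _)); last first.
    by rewrite half_massE// norm1_massE ?divr_gt0// -EFinM -EFinD lte_fin.
  move=> x; rewrite /f; have [xM|xM] := leP (norm1 x) M.
    rewrite clamped_dot_emb//; apply: lerD.
      have [h|h] := leP (dotv xi x) s'; first by rewrite ramp0.
      by rewrite indic_in// ramp_le1.
    have [h|h] := leP (norm1 x) (M / 2).
      by rewrite ramp0 ?mulr_ge0// (le_trans (clamped_norm_le _ (ltW M0))).
    by rewrite indic_in// mulr1 (le_trans (ramp_le1 _ _ _))//; lra.
  rewrite (@indic_in _ _ [set x | M / 2 < norm1 x]) /=; last lra.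
  have := ramp_le1 s' s (clamped_dot M xi (emb x)).
  have := ramp_le1 (M / 2) M (clamped_norm M (emb x)).
  by have : 0 <= \1_(halfspace xi s') x :> R by []; lra.
have /(_ _ (open_ereal_lt' If)) /= fk := acvg Cf.
near=> k.
have ak : 0 < a k by near: k; exact: (cvgry_gt aoo).
have : (k%:R%:E * (\int[P]_w (f (emb ((a k)^-1 *: X w)))%:E) < eta%:E)%E by near: k.
rewrite -lee_fin => /ltW; apply: le_trans; apply: integral_ge => // x.
have [h|h] := leP (dotv xi x) s; first by rewrite indic_notin// /halfspace/= ltNge h.
rewrite indic_in// /f.
have [xM|xM] := leP (norm1 x) M.
  by rewrite clamped_dot_emb// (ramp1 s's (ltW h)) lerDl ramp_ge0.
by rewrite (@ramp1 _ (M / 2))// ?lerDr ?ramp_ge0// clamped_norm_ge// ltW.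
Unshelve. all: by end_near. Qed.

Lemma tail_lb (s s' M eta : R) : 0 < s < s' -> 0 < M ->
  eta < s' `^ (- alpha) * half_mass xi - 2 * (M / 2) `^ (- alpha) ->
  \forall k \near \oo, eta <= k%:R * p (a k * s).
Proof.
move=> /andP[s0 ss'] M0 eta_lt.
(* Subtracting the second ramp makes [f] vanish where [norm1] exceeds [M], so that [f] stays below
   the indicator of the half-space; the maximum with 0 keeps it nonnegative. *)
pose f y := Num.max 0
  (ramp s s' (clamped_dot M xi y) - ramp (M / 2) M (clamped_norm M y)).
have M2 : M / 2 < M by lra.
have cf : continuous f.
  move=> y; apply: (@continuous_max R _ (fun=> 0) (fun y =>
    ramp s s' (clamped_dot M xi y) - ramp (M / 2) M (clamped_norm M y))).
    exact: cst_continuous.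
  exact: (cvgB (@continuous_ramp_dot _ _ _ xi s s' M0 y)
    (@continuous_ramp_norm _ _ _ (M / 2) M M0 y)).
have f0 y : 0 <= f y by rewrite le_max lexx.
have [delta d0 fd] := ramp_away xi M0 s0 ss' M2.
have Cf : Cc_punctured f.
  by apply: (Cc_punctured_away d0) => // y /fd[f1 f2]; rewrite /f f1 f2 subr0 maxxx.
have If : (eta%:E < \int[nu]_y (f y)%:E)%E.
  have := mrv_limit_integral_ge mrvX cf f0
    (measurable_halfspace xi s') (measurable_norm1_gt (M / 2)).
  rewrite half_massE ?(lt_trans s0)// norm1_massE ?divr_gt0// -EFinM.
  rewrite -leeBlDr// -EFinB => H; apply: lt_le_trans (H _); first by rewrite lte_fin.
  move=> x; rewrite /f; have [xM|xM] := leP (norm1 x) (M / 2).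
    rewrite (@ramp0 _ (M / 2))//; last exact: le_trans (clamped_norm_le _ (ltW M0)) xM.
    rewrite clamped_dot_emb//; last lra.
    rewrite subr0 max_r ?ramp_ge0//; have [h|h] := leP (dotv xi x) s'.
      by rewrite indic_notin ?addr_ge0 ?ramp_ge0 ?mulr_ge0// /halfspace/= ltNge h.
    rewrite (@indic_in _ _ (halfspace xi s'))// (ramp1 ss' (ltW h)).
    by rewrite lerDl mulr_ge0.
  rewrite (@indic_in _ _ [set x | M / 2 < norm1 x])//.
  have h1 : \1_(halfspace xi s') x <= 1 :> R by rewrite indicE lern1 leq_b1.
  by rewrite (le_trans h1)// mulr1; have := f0 (emb x); rewrite /f; lra.
have /(_ _ (open_ereal_gt' If)) /= fk := acvg Cf.
near=> k.
have ak : 0 < a k by near: k; exact: (cvgry_gt aoo).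
have : (eta%:E < k%:R%:E * (\int[P]_w (f (emb ((a k)^-1 *: X w)))%:E))%E by near: k.
rewrite -lee_fin => /ltW h; apply: (le_trans h); apply: integral_le => // x.
rewrite /f ge_max indicE ler0n /= -indicE; have [xM|xM] := leP (norm1 x) M.
  rewrite clamped_dot_emb//; have [h1|h1] := leP (dotv xi x) s.
    by rewrite (@ramp0 _ s s')// sub0r (@le_trans _ _ 0)// ?oppr_le0 ?ramp_ge0.
  rewrite indic_in//.
  by have := ramp_le1 s s' (dotv xi x); have := ramp_ge0 (M / 2) M (clamped_norm M (emb x)); lra.
rewrite (@ramp1 _ (M / 2))//; last by rewrite clamped_norm_ge// ltW.
have := ramp_le1 s s' (clamped_dot M xi (emb x)).
by have : 0 <= \1_(halfspace xi s) x :> R by []; lra.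
Unshelve. all: by end_near. Qed.

End bounds.
End tails.

(** * Regular variation along a continuous parameter *)

Lemma powRKV (R : realType) (x y : R) : 0 <= x -> y != 0 -> (x `^ y^-1) `^ y = x.
Proof. by move=> x0 y0; rewrite -powRrM mulVf// powRr1. Qed.

Lemma powR_continuous (R : realType) (y s : R) : 0 < s ->
  {for s, continuous (fun x : R => x `^ y)}.
Proof.
move=> s0; apply: differentiable_continuous; apply/derivable1_diffP.
by apply: derivable_powR; rewrite in_itv/= s0.
Qed.

Section tail_cvg.
Variables (R : realType) (n : nat) (d : measure_display) (T : measurableType d).
Variables (P : probability T R) (X : T -> 'rV[R]_n) (alpha : R).
Variable nu : {measure set (borel_erV R n) -> \bar R}.
Hypothesis alpha_gt0 : 0 < alpha.
Hypothesis nuX : exponent_measure P alpha X nu.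
Hypothesis mX : measurable_fun setT (X : T -> borel_rV R n).

(** By homogeneity the mass of a half-space is continuous in its level, so its boundary carries no
    obstruction: the levels [s1 < s < s2] of the two one-sided bounds can be brought to [s]. *)
Lemma exponent_tail_cvg : exists2 a : nat -> R, a k @[k --> \oo] --> +oo &
  forall (xi : 'rV[R]_n) (s : R), 0 < s ->
    (k%:R * fine (P [set w | (a k * s < dotv xi (X w))%R])) @[k --> \oo] -->
      s `^ (- alpha) * half_mass nu xi.
Proof.
have [[_ _ _ [a aoo acvg] _] _] := nuX.
exists a => // xi s s0; apply/cvgrPdist_le => e e0.
(* With this [M] the clamping error is [2 * (e / 8) = e / 4]; moving the level from [s] to [s1] or
   [s2] costs at most [e / 2], which leaves room below [e]. *)
pose M := 2 * (e / 8) `^ (- alpha)^-1.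
have M0 : 0 < M by rewrite mulr_gt0// powR_gt0//; lra.
have ME : (M / 2) `^ (- alpha) = e / 8.
  by rewrite /M mulrC mulKf// powRKV ?oppr_eq0 ?gt_eqF//; lra.
have cs : (fun t => t `^ (- alpha) * half_mass nu xi) @ s -->
    s `^ (- alpha) * half_mass nu xi.
  by apply: cvgM; [exact: powR_continuous|exact: cvg_cst].
have /cvgrPdist_lt/(_ (e / 2)) cs' := cs.
have e2 : 0 < e / 2 by lra.
have [s1 [s10 s1s] h1] : exists2 s1, 0 < s1 /\ s1 < s &
    s1 `^ (- alpha) * half_mass nu xi < s `^ (- alpha) * half_mass nu xi + e / 2.
  have : \forall t \near s^'-, `|s `^ (- alpha) * half_mass nu xi -
      t `^ (- alpha) * half_mass nu xi| < e / 2 by apply: cvg_within; exact: cs'.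
  move=> near1; near s^'- => t; exists t; first split=> //.
  have : `|s `^ (- alpha) * half_mass nu xi -
      t `^ (- alpha) * half_mass nu xi| < e / 2 by near: t.
  by rewrite ltr_norml => /andP[]; lra.
have [s2 s2s h2] : exists2 s2, s < s2 &
    s `^ (- alpha) * half_mass nu xi - e / 2 < s2 `^ (- alpha) * half_mass nu xi.
  have : \forall t \near s^'+, `|s `^ (- alpha) * half_mass nu xi -
      t `^ (- alpha) * half_mass nu xi| < e / 2 by apply: cvg_within; exact: cs'.
  move=> near1; near s^'+ => t; exists t => //.
  have : `|s `^ (- alpha) * half_mass nu xi -
      t `^ (- alpha) * half_mass nu xi| < e / 2 by near: t.
  by rewrite ltr_norml => /andP[]; lra.
have H1 := @tail_ub _ _ _ _ _ _ _ _ nuX mX _ aoo acvg xi s s1 M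
  (s `^ (- alpha) * half_mass nu xi + e).
have H2 := @tail_lb _ _ _ _ _ _ _ _ nuX mX _ aoo acvg xi s s2 M
  (s `^ (- alpha) * half_mass nu xi - e).
rewrite ME in H1 H2.
near=> k; rewrite ler_norml; apply/andP; split.
  rewrite -subr_ge0 opprK addrAC subr_ge0; near: k; apply: H1 => //; last lra.
  by rewrite s10.
rewrite lerBlDr addrC -lerBlDr; near: k; apply: H2 => //; last lra.
by rewrite s0.
Unshelve. all: by end_near. Qed.

End tail_cvg.

(* The sequence [a] need not be monotone.  Given t, take k with k * phi t close to
   b; comparing with k * phi (a k * s) for s on both sides of 1 locates t between
   two multiples of [a k], and p t follows. *)
Section ratio.
Variables (R : realType) (a : nat -> R) (phi p : R -> R) (alpha b c : R).
Hypotheses (aoo : a k @[k --> \oo] --> +oo) (alpha_gt0 : 0 < alpha).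
Hypotheses (b0 : 0 < b) (c0 : 0 <= c).
Hypothesis phi_ni : forall x y, x <= y -> phi y <= phi x.
Hypothesis p_ni : forall x y, x <= y -> p y <= p x.
Hypothesis p_ge0 : forall x, 0 <= p x.
Hypothesis phi_cvg : forall s, 0 < s ->
  k%:R * phi (a k * s) @[k --> \oo] --> s `^ (- alpha) * b.
Hypothesis p_cvg : forall s, 0 < s ->
  k%:R * p (a k * s) @[k --> \oo] --> s `^ (- alpha) * c.

Let phi_cvg1 : k%:R * phi (a k) @[k --> \oo] --> b.
Proof. by have := phi_cvg ltr01; rewrite powR1 mul1r; under eq_fun do rewrite mulr1. Qed.

Lemma regular_tail_gt0 t : 0 < phi t.
Proof.
near \oo => k.
have tk : t <= a k by near: k; exact: cvgry_ge.
apply: lt_le_trans (phi_ni tk).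
have : 0 < k%:R * phi (a k) by near: k; exact: (cvgr_gt _ phi_cvg1).
have [->|k0] := eqVneq k 0%N; first by rewrite mul0r ltxx.
by rewrite pmulr_rgt0// ltr0n lt0n.
Unshelve. all: by end_near. Qed.

Lemma regular_tail_cvg0 eta : 0 < eta -> \forall t \near +oo, phi t <= eta.
Proof.
move=> eta0; near \oo => k.
have k0 : 0 < k%:R :> R by near: k; exact: nbhs_infty_gtr.
have kb : (b + 1) / eta <= k%:R by near: k; exact: nbhs_infty_ger.
have h : k%:R * phi (a k) <= b + 1.
  by near: k; apply: (cvgr_le _ phi_cvg1); rewrite ltrDl.
near=> t; apply: (@le_trans _ _ (phi (a k))).
  by apply: phi_ni; near: t; apply: nbhs_pinfty_ge; exact: num_real.
rewrite -(ler_pM2l k0) (le_trans h)//.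
by move: kb; rewrite ler_pdivrMr.
Unshelve. all: by end_near. Qed.

Lemma tail_ratio_cvg : p t / phi t @[t --> +oo] --> c / b.
Proof.
suff H (e : R) : 0 < e -> \forall t \near +oo, `|c / b - p t / phi t| <= e.
  exact/cvgrPdist_le.
move=> e0; have c0' := c0; have b0' := b0.
have [q [q0 qb ->]] : exists q : R, [/\ 0 <= q, q * b = c & c / b = q].
  by exists (c / b); rewrite divfK ?gt_eqF// divr_ge0// ltW.
(* [D] is the coefficient of [dl] in the comparison [(q + e) * (b - dl) < (1 + dl) * c + dl] that
   [r > q + e] would entail; as [q * b = c], it amounts to [e * b < dl * D], which the choice of
   [dl] excludes. The lower bound needs no more. *)
pose D := c + 1 + q + e.
have D0 : 0 < D by rewrite /D; lra.
pose dl := e * b / D.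
have dl0 : 0 < dl by rewrite divr_gt0// mulr_gt0.
have dlD : dl * D = e * b by rewrite /dl divfK// gt_eqF.
have dlb : dl < b.
  by rewrite -(ltr_pM2r D0) dlD mulrC ltr_pM2l// /D; lra.
pose l := (1 + dl) `^ alpha^-1.
have l0 : 0 < l by rewrite powR_gt0//; lra.
have lE : l `^ alpha = 1 + dl by rewrite powRKV ?gt_eqF//; lra.
have lVE : l `^ (- alpha) = (1 + dl)^-1 by rewrite powRN lE.
have lV : l^-1 `^ (- alpha) = 1 + dl.
  rewrite powRN -[l^-1]powR_inv1 ?ltW// -powRrM mulN1r powRN invrK//.
have lV0 : 0 < l^-1 by rewrite invr_gt0.
have l1 : 1 - dl <= (1 + dl)^-1.
  by rewrite -div1r ler_pdivlMr; nra.
have l2 : (1 + dl)^-1 < 1 by rewrite invf_lt1; lra.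
have f1 : \forall k \near \oo, b < k%:R * phi (a k * l^-1).
  by apply: (cvgr_gt _ (phi_cvg lV0)); rewrite lV; nra.
have f2 : \forall k \near \oo, k%:R * p (a k * l^-1) <= (1 + dl) * c + dl.
  by apply: (cvgr_le _ (p_cvg lV0)); rewrite lV; lra.
have f3 : \forall k \near \oo, k%:R * phi (a k * l) < b.
  by apply: (cvgr_lt _ (phi_cvg l0)); rewrite lVE; nra.
have f4 : \forall k \near \oo, (1 + dl)^-1 * c - dl <= k%:R * p (a k * l).
  by apply: (cvgr_ge _ (p_cvg l0)); rewrite lVE; lra.
have [N _ HN] : \forall k \near \oo, [/\ b < k%:R * phi (a k * l^-1),
    k%:R * p (a k * l^-1) <= (1 + dl) * c + dl, k%:R * phi (a k * l) < b &
    (1 + dl)^-1 * c - dl <= k%:R * p (a k * l)].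
  by near=> k; split; near: k.
near=> t.
have ft := regular_tail_gt0 t.
have ftd : phi t <= dl by near: t; exact: regular_tail_cvg0.
have ftN : phi t <= b / N.+1%:R by near: t; apply: regular_tail_cvg0; rewrite divr_gt0.
(* Since [k * phi t <= b < k.+1 * phi t], the index [k] gives [a k / l < t] and the index [k.+1]
   gives [t < a k.+1 * l]. The shift of one is harmless: it changes [k * phi t] by [phi t <= dl]. *)
pose k := Num.truncn (b / phi t).
have bt : 0 <= b / phi t by rewrite divr_ge0// ltW.
have /andP[k1 k2] := truncn_itv bt; rewrite -/k in k1 k2.
have Nk : (N < k)%N.
  rewrite -ltnS -(ltr_nat R) (le_lt_trans _ k2)//.
  by rewrite ler_pdivlMr// mulrC -ler_pdivlMr ?ltr0n.
have k0 : 0 < k%:R :> R by rewrite ltr0n (leq_ltn_trans _ Nk).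
have K0 : 0 < k.+1%:R :> R by [].
have kphi : k%:R * phi t <= b by rewrite -ler_pdivlMr.
have Kphi : b < k.+1%:R * phi t by rewrite -ltr_pdivrMr.
have [h1 h2 _ _] := HN k (ltnW Nk).
have [_ _ h3 h4] := HN k.+1 (leqW (ltnW Nk)).
have pt0 : p t / phi t * phi t = p t by rewrite divfK// gt_eqF.
have ku : k%:R * p t <= (1 + dl) * c + dl.
  rewrite (le_trans _ h2)// ler_wpM2l ?ler0n//; apply: p_ni; apply/ltW.
  rewrite ltNge; apply/negP => /phi_ni h; move: h1; rewrite ltNge.
  by rewrite (le_trans _ kphi)// ler_wpM2l ?ler0n.
have kl : (1 + dl)^-1 * c - dl <= k.+1%:R * p t.
  rewrite (le_trans h4)// ler_wpM2l ?ler0n//; apply: p_ni; apply/ltW.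
  rewrite ltNge; apply/negP => /phi_ni h; move: h3; rewrite ltNge.
  by rewrite (le_trans (ltW Kphi))// ler_wpM2l ?ler0n.
have kS : k.+1%:R = k%:R + 1 :> R by rewrite -natr1.
have [r [rpt ->]] : exists r : R, r * phi t = p t /\ p t / phi t = r.
  by exists (p t / phi t).
rewrite kS in Kphi kl.
have u1 : r <= q + e.
  rewrite leNgt; apply/negP => hr.
  have q1 : (q + e) * (b - dl) < r * (k%:R * phi t).
    apply: (@le_lt_trans _ _ ((q + e) * (k%:R * phi t))).
      by rewrite ler_wpM2l ?addr_ge0 ?(ltW e0)//; lra.
    by rewrite ltr_pM2r// mulr_gt0.
  have q2 : r * (k%:R * phi t) = k%:R * p t by rewrite mulrCA rpt.
  move: q1; rewrite q2 /D in dlD *; move: dlD; rewrite /D; nra.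
have u2 : q - e <= r.
  rewrite leNgt; apply/negP => hr.
  have q2 : r * ((k%:R + 1) * phi t) = (k%:R + 1) * p t by rewrite mulrCA rpt.
  have [ce|ce] := leP (q - e) 0.
    have r0 : r < 0 by lra.
    by have := p_ge0 t; rewrite -rpt pmulr_lge0// leNgt r0.
  have q1 : r * ((k%:R + 1) * phi t) < (q - e) * (b + dl).
    apply: (@lt_le_trans _ _ ((q - e) * ((k%:R + 1) * phi t))).
      by rewrite ltr_pM2r//; lra.
    by rewrite ler_pM2l//; lra.
  move: q1; rewrite q2; move: dlD; rewrite /D; nra.
by rewrite ler_norml; apply/andP; split; lra.
Unshelve. all: by end_near. Qed.
End ratio.

(** * Coordinate tails and balanced tails *)

Section coordinates.
Variables (R : realType) (n : nat).
Implicit Types (xi x : 'rV[R]_n).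

Lemma dotv_delta i x : dotv (delta_mx ord0 i) x = x ord0 i.
Proof.
rewrite /dotv (bigD1 i)//= big1 ?addr0; first by rewrite mxE !eqxx mul1r.
by move=> j ji; rewrite mxE (negPf ji) andbF mul0r.
Qed.

Lemma dotvN xi x : dotv (- xi) x = - dotv xi x.
Proof. by rewrite /dotv -sumrN; apply: eq_bigr => i _; rewrite mxE mulNr. Qed.

(** Two disjoint half-spaces with opposite normals reduce the sets [Bset i] and the tails of
    absolute values to linear functionals. This is why the limits above are proved for vectors [xi]
    of arbitrary sign. *)
Lemma abs_gtE (t : R) (i : 'I_n) : 0 <= t -> [set x : 'rV[R]_n | t < `|x ord0 i|] =
  halfspace (delta_mx ord0 i) t `|` halfspace (- delta_mx ord0 i) t.
Proof.
move=> t0; apply/seteqP; split=> x; rewrite /halfspace/= dotvN dotv_delta lter_normr.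
  by move=> /orP.
by move=> /orP.
Qed.

Lemma halfspace_deltaI (t : R) (i : 'I_n) : 0 <= t ->
  halfspace (delta_mx ord0 i) t `&` halfspace (- delta_mx ord0 i) t = set0.
Proof.
move=> t0; apply/seteqP; split=> x; rewrite /halfspace/= dotvN dotv_delta//.
by move=> [] h1 h2; lra.
Qed.

End coordinates.

Section balanced.
Variables (R : realType) (n : nat) (d : measure_display) (T : measurableType d).
Variables (P : probability T R) (X : T -> 'rV[R]_n) (alpha : R).
Variable nu : {measure set (borel_erV R n) -> \bar R}.
Hypothesis alpha_gt0 : 0 < alpha.
Hypothesis nuX : exponent_measure P alpha X nu.
Hypothesis mX : measurable_fun setT (X : T -> borel_rV R n).

Definition abs_tail (i : 'I_n) (t : R) : R := fine (P [set w | t < `|X w ord0 i|]).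

Definition abs_mass (i : 'I_n) : R := fine (nu (@emb R n @` @Bset R n i)).

Lemma measurable_abs_gt (i : 'I_n) (t : R) :
  measurable ([set x | t < `|x ord0 i|] : set (borel_rV R n)).
Proof.
apply: measurable_gt => x.
exact: (cvg_norm (@continuous_coord _ _ _ ord0 i x)).
Qed.

Lemma measurable_preimage_rV (A : set 'rV[R]_n) :
  measurable (A : set (borel_rV R n)) -> measurable [set w | A (X w)].
Proof. by move=> mA; rewrite -[X in measurable X]setTI; exact: (mX measurableT mA). Qed.

Lemma abs_tailE i t : P [set w | t < `|X w ord0 i|] = (abs_tail i t)%:E.
Proof.
rewrite /abs_tail fineK// fin_num_measure//.
exact: (measurable_preimage_rV (measurable_abs_gt i t)).
Qed.

Lemma abs_tail_ge0 i t : 0 <= abs_tail i t.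
Proof. by rewrite fine_ge0. Qed.

Lemma abs_tail_nonincr i x y : x <= y -> abs_tail i y <= abs_tail i x.
Proof.
move=> xy; rewrite -lee_fin -!abs_tailE le_measure ?inE//.
- exact: (measurable_preimage_rV (measurable_abs_gt i y)).
- exact: (measurable_preimage_rV (measurable_abs_gt i x)).
- by move=> w /=; exact: le_lt_trans.
Qed.

Definition dot_tail (xi : 'rV[R]_n) (t : R) : R := fine (P [set w | t < dotv xi (X w)]).

Lemma dot_tailE xi t : P [set w | t < dotv xi (X w)] = (dot_tail xi t)%:E.
Proof.
rewrite /dot_tail fineK// fin_num_measure//.
exact: (measurable_preimage_rV (measurable_halfspace xi t)).
Qed.

Lemma dot_tail_ge0 xi t : 0 <= dot_tail xi t.
Proof. by rewrite fine_ge0. Qed.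

Lemma dot_tail_nonincr xi x y : x <= y -> dot_tail xi y <= dot_tail xi x.
Proof.
move=> xy; rewrite -lee_fin -!dot_tailE le_measure ?inE//.
- exact: (measurable_preimage_rV (measurable_halfspace xi y)).
- exact: (measurable_preimage_rV (measurable_halfspace xi x)).
- by move=> w /=; exact: le_lt_trans.
Qed.

Lemma abs_tailD i t : 0 <= t ->
  abs_tail i t = dot_tail (delta_mx ord0 i) t + dot_tail (- delta_mx ord0 i) t.
Proof.
move=> t0; apply: EFin_inj; rewrite EFinD -abs_tailE -!dot_tailE -measureU.
- congr (P _); apply/seteqP; split=> w; rewrite /= dotvN dotv_delta lter_normr.
    by move=> /orP.
  by move=> /orP.
- exact: (measurable_preimage_rV (measurable_halfspace _ t)).
- exact: (measurable_preimage_rV (measurable_halfspace _ t)).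
- by rewrite -[RHS](preimage_set0 X) -(halfspace_deltaI i t0).
Qed.

Lemma abs_massE i :
  abs_mass i = half_mass nu (delta_mx ord0 i) + half_mass nu (- delta_mx ord0 i).
Proof.
have h xi := half_massE nuX xi ltr01.
have E : Bset i = _ := @abs_gtE R n 1 i ler01.
pose H xi : set (borel_erV R n) := @emb R n @` halfspace xi 1.
have mH xi : measurable (H xi) by apply: measurable_emb; exact: measurable_halfspace.
have : nu (H (delta_mx ord0 i) `|` H (- delta_mx ord0 i)%R) =
    (nu (H (delta_mx ord0 i)) + nu (H (- delta_mx ord0 i)%R))%E.
  apply: measureU => //.
  apply/seteqP; split=> // _ [[x h1 <-] [y h2 /emb_inj yx]].
  have /= := halfspace_deltaI (R := R) i ler01.
  by move=> /seteqP[/(_ x) + _]; apply; split=> //; rewrite -yx.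
by rewrite /abs_mass E image_setU /H !h powR1 !mul1r => ->.
Qed.

Lemma exponent_abs_tail_cvg : exists2 a : nat -> R, a k @[k --> \oo] --> +oo &
  (forall xi s, 0 < s -> k%:R * dot_tail xi (a k * s) @[k --> \oo] -->
      s `^ (- alpha) * half_mass nu xi) /\
  (forall i s, 0 < s -> k%:R * abs_tail i (a k * s) @[k --> \oo] -->
      s `^ (- alpha) * abs_mass i).
Proof.
have [a aoo acvg] := exponent_tail_cvg alpha_gt0 nuX mX.
exists a => //; split=> // i s s0.
rewrite abs_massE mulrDr.
apply: cvg_trans (cvgD (acvg (delta_mx ord0 i) s s0) (acvg (- delta_mx ord0 i) s s0)).
apply: near_eq_cvg; near=> k => /=.
rewrite abs_tailD ?mulrDr// mulr_ge0 ?(ltW s0)//.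
near: k; exact: cvgry_ge.
Unshelve. all: by end_near. Qed.

Variable i : 'I_n.
Hypothesis bi : (0 < nu (@emb R n @` Bset i))%E.

(** Since [fine] sends [+oo] to 0, positivity of the mass is not enough; finiteness comes from the
    two half-spaces that make up [Bset i]. *)
Lemma abs_mass_gt0 : 0 < abs_mass i.
Proof.
have E : Bset i = _ := @abs_gtE R n 1 i ler01.
rewrite /abs_mass fine_gt0// bi /=.
have h xi := half_massE nuX xi ltr01.
pose H xi : set (borel_erV R n) := @emb R n @` halfspace xi 1.
have mH xi : measurable (H xi) by apply: measurable_emb; exact: measurable_halfspace.
have : (nu (H (delta_mx ord0 i) `|` H (- delta_mx ord0 i)%R) <=
    nu (H (delta_mx ord0 i)) + nu (H (- delta_mx ord0 i)%R))%E.
  exact: measureU2.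
by rewrite E image_setU /H !h => /le_lt_trans; apply; rewrite -EFinD ltry.
Qed.

Lemma abs_tail_gt0 t : 0 < abs_tail i t.
Proof.
have [a aoo [_ /(_ i) acvg]] := exponent_abs_tail_cvg.
exact: (regular_tail_gt0 aoo abs_mass_gt0 (@abs_tail_nonincr i) acvg).
Qed.

Lemma dot_tail_ratio_cvg xi :
  dot_tail xi t / abs_tail i t @[t --> +oo] --> half_mass nu xi / abs_mass i.
Proof.
have [a aoo [dcvg acvg]] := exponent_abs_tail_cvg.
apply: (tail_ratio_cvg aoo alpha_gt0 abs_mass_gt0 (half_mass_ge0 nu xi)
  (@abs_tail_nonincr i) (@dot_tail_nonincr xi) (dot_tail_ge0 xi) (acvg i) (dcvg xi)).
Qed.

Lemma abs_tail_ratio_cvg j :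
  abs_tail j t / abs_tail i t @[t --> +oo] --> abs_mass j / abs_mass i.
Proof.
have [a aoo [dcvg acvg]] := exponent_abs_tail_cvg.
have j0 : 0 <= abs_mass j by rewrite fine_ge0.
apply: (tail_ratio_cvg aoo alpha_gt0 abs_mass_gt0 j0
  (@abs_tail_nonincr i) (@abs_tail_nonincr j) (abs_tail_ge0 j) (acvg i) (acvg j)).
Qed.

(** An instance of [tail_ratio_cvg] in which the second function is the tail dilated by [l]; its
    constant along the normalizing sequence is [l ^ (- alpha)] times that of the tail itself. *)
Lemma abs_tail_regular (l : R) : 0 < l ->
  abs_tail i (l * t) / abs_tail i t @[t --> +oo] --> l `^ (- alpha).
Proof.
move=> l0; have [a aoo [dcvg acvg]] := exponent_abs_tail_cvg.
have b0 := abs_mass_gt0.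
have c0 : 0 <= l `^ (- alpha) * abs_mass i by rewrite mulr_ge0 ?powR_ge0// ltW.
rewrite -[X in _ --> X](mulfK (lt0r_neq0 b0)).
apply: (tail_ratio_cvg (p := fun t => abs_tail i (l * t)) aoo alpha_gt0 b0 c0
  (@abs_tail_nonincr i) _ _ (acvg i)).
- by move=> x y xy; apply: abs_tail_nonincr; rewrite ler_pM2l.
- by move=> x; exact: abs_tail_ge0.
- move=> s s0; have := acvg i (l * s) (mulr_gt0 l0 s0).
  rewrite powRM ?(ltW l0) ?(ltW s0)// [l `^ _ * _]mulrC -mulrA.
  by under eq_fun do rewrite mulrCA.
Qed.

End balanced.

(** The same ratio of tails tends to the ratio of the masses, by regular variation, and to 1, by
    balance. As a consequence [Tmap] applies the same scaling to all coordinates. *)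
Lemma balanced_abs_mass (R : realType) (n : nat) (d : measure_display)
    (T : measurableType d) (P : probability T R) (X : T -> 'rV[R]_n) (alpha : R)
    (nu : {measure set (borel_erV R n) -> \bar R}) (i j : 'I_n) :
  0 < alpha -> exponent_measure P alpha X nu ->
  measurable_fun setT (X : T -> borel_rV R n) ->
  (0 < nu (@emb R n @` Bset i))%E -> balanced_tails P X ->
  abs_mass nu j = abs_mass nu i.
Proof.
move=> a0 nuX mX bi bal.
have b0 := abs_mass_gt0 nuX bi.
have h1 : abs_tail P X j t / abs_tail P X i t @[t --> +oo] -->
    abs_mass nu j / abs_mass nu i by exact: (abs_tail_ratio_cvg a0 nuX mX bi).
have h2 : abs_tail P X j t / abs_tail P X i t @[t --> +oo] --> (1 : R).
  apply: cvg_trans (fine_cvg (bal j i)).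
  apply: near_eq_cvg; near=> t; rewrite /= /tail_ratio !abs_tailE//.
  by rewrite eqe gt_eqF// (abs_tail_gt0 a0 nuX).
have e : abs_mass nu j / abs_mass nu i = 1.
  by rewrite -(cvg_lim (@Rhausdorff R) h1) (cvg_lim (@Rhausdorff R) h2).
by rewrite -[LHS](divfK (lt0r_neq0 b0)) e mul1r.
Unshelve. all: by end_near. Qed.

(** * The canonical spectral measure *)

Section talpha.
Variable R : realType.
Implicit Types (alpha c t y : R).

Lemma Talpha_scale alpha c t : 0 <= c ->
  Talpha alpha (c * t) = c `^ alpha^-1 * Talpha alpha t.
Proof.
move=> c0; rewrite /Talpha /pospart /negpart mulrBr -!powRM ?le_max ?lexx ?orbT//.
by rewrite !maxr_pMr// !mulr0 mulrN.
Qed.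

Lemma TalphaE alpha t : alpha != 0 ->
  Talpha alpha t = if 0 <= t then t `^ alpha^-1 else - (- t) `^ alpha^-1.
Proof.
move=> a0; rewrite /Talpha /pospart /negpart.
have a1 : alpha^-1 != 0 by rewrite invr_eq0.
have [t0|t0] := leP 0 t.
  by rewrite [Num.max (- t) 0]max_r ?oppr_le0// powR0// subr0.
by rewrite [Num.max (- t) 0]max_l ?oppr_ge0 ?ltW// powR0// sub0r.
Qed.

Lemma normr_Talpha alpha t : 0 < alpha -> `|Talpha alpha t| `^ alpha = `|t|.
Proof.
move=> a0; rewrite TalphaE ?gt_eqF//.
case: (leP 0 t) => t0.
  by rewrite ger0_norm ?powR_ge0// powRKV ?gt_eqF// ger0_norm.
by rewrite normrN ger0_norm ?powR_ge0// powRKV ?gt_eqF ?ltr0_norm ?oppr_ge0 ?(ltW t0).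
Qed.

Lemma Talpha_surj alpha y : 0 < alpha -> exists t, Talpha alpha t = y.
Proof.
move=> a0; have K (x : R) : 0 <= x -> (x `^ alpha) `^ alpha^-1 = x.
  by move=> x0; rewrite -powRrM mulfV ?gt_eqF// powRr1.
have [y0|y0] := leP 0 y.
  by exists (y `^ alpha); rewrite TalphaE ?gt_eqF// powR_ge0 K.
exists (- (- y) `^ alpha); rewrite TalphaE ?gt_eqF//.
have p0 : 0 < (- y) `^ alpha by rewrite powR_gt0// oppr_gt0.
by rewrite leNgt oppr_lt0 p0/= opprK K ?opprK// oppr_ge0 ltW.
Qed.

End talpha.

Lemma measurable_lt_fun d (T : measurableType d) (R : realType) (f g : T -> R) :
  measurable_fun setT f -> measurable_fun setT g -> measurable [set x | f x < g x].
Proof.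
move=> mf mg; rewrite -[X in measurable X]setTI.
have -> : [set x | f x < g x] = (g \- f) @^-1` `]0, +oo[%classic.
  by apply/seteqP; split=> x /=; rewrite in_itv/= andbT subr_gt0.
by apply: (measurable_funB mg mf) => //; exact: measurable_itv.
Qed.

Lemma measurable_le_fun d (T : measurableType d) (R : realType) (f g : T -> R) :
  measurable_fun setT f -> measurable_fun setT g -> measurable [set x | f x <= g x].
Proof.
move=> mf mg; have -> : [set x | f x <= g x] = ~` [set x | g x < f x].
  apply/seteqP; split=> x /=; first by rewrite leNgt => /negP.
  by move=> /negP; rewrite -leNgt.
by apply: measurableC; exact: measurable_lt_fun.
Qed.

Section spectral.
Variables (R : realType) (n : nat) (alpha b : R) (xi : 'rV[R]_n).
Variable nu : {measure set (borel_erV R n) -> \bar R}.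
Variable Psi : {finite_measure set (borel_rV R n) -> \bar R}.
Hypotheses (alpha_gt0 : 0 < alpha) (b_gt0 : 0 < b).
Hypothesis massE : forall i, abs_mass nu i = b.
Hypothesis Psi_spec : forall (r : R) (B : set (borel_rV R n)), 0 < r ->
  measurable B -> B `<=` @sphere1 R n ->
  canonical_exponent alpha nu
    [set x | r < norm1 x /\ B ((norm1 x)^-1 *: x)] = (r^-1%:E * Psi B)%E.

(* Everything is transported to z = T y, where g (y / norm1 y) = G z / N z: this way
   no regularity of the inverse of T is needed. *)
Let G (z : 'rV[R]_n) : R := pospart (dotv xi z) `^ alpha.
Let N (z : 'rV[R]_n) : R := \sum_i `|z ord0 i| `^ alpha.
Let g : 'rV[R]_n -> R := gfun xi alpha.

Let TE y i : Tmap alpha nu y ord0 i = b `^ alpha^-1 * Talpha alpha (y ord0 i).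
Proof.
rewrite mxE [fine _](massE i) Talpha_scale// ltW//.
Qed.

Let G_T y : G (Tmap alpha nu y) = b * g y.
Proof.
rewrite /G /g /gfun /dotv.
under eq_bigr do rewrite TE mulrCA.
rewrite -mulr_sumr /pospart.
rewrite -[X in Num.max _ X](mulr0 (b `^ alpha^-1)) -maxr_pMr ?powR_ge0//.
by rewrite powRM ?powR_ge0 ?le_max ?lexx ?orbT// powRKV ?gt_eqF ?ltW.
Qed.

Let N_T y : N (Tmap alpha nu y) = b * norm1 y.
Proof.
rewrite /N /norm1 mulr_sumr; apply: eq_bigr => i _.
rewrite TE normrM powRM// ger0_norm ?powR_ge0// powRKV ?gt_eqF ?(ltW b_gt0)//.
by rewrite normr_Talpha.
Qed.

Let T_surj z : exists y, Tmap alpha nu y = z.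
Proof.
have h i : exists t, b `^ alpha^-1 * Talpha alpha t = z ord0 i.
  have [t tE] := Talpha_surj (z ord0 i / b `^ alpha^-1) alpha_gt0.
  by exists t; rewrite tE mulrC divfK// gt_eqF// powR_gt0.
pose f i := sval (cid (h i)).
exists (\row_i f i); apply/rowP => i.
by rewrite TE mxE /f; case: cid.
Qed.

Let gZ (c : R) y : 0 <= c -> g (c *: y) = c * g y.
Proof.
move=> c0; have a1 : 0 <= c `^ alpha^-1 by exact: powR_ge0.
have e : \sum_i xi ord0 i * Talpha alpha ((c *: y) ord0 i) =
    c `^ alpha^-1 * \sum_i xi ord0 i * Talpha alpha (y ord0 i).
  by rewrite mulr_sumr; apply: eq_bigr => i _; rewrite mxE Talpha_scale// mulrCA.
rewrite /g /gfun [X in pospart X]e /pospart.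
rewrite -[X in Num.max _ X](mulr0 (c `^ alpha^-1)) -maxr_pMr//.
by rewrite powRM ?le_max ?lexx ?orbT// powRKV ?gt_eqF.
Qed.

Let g_ge0 y : 0 <= g y. Proof. exact: powR_ge0. Qed.

Let coord_meas (i : 'I_n) :
  measurable_fun setT (fun x : borel_rV R n => (x : 'rV[R]_n) ord0 i).
Proof. by apply: continuous_measurable_borelR => x; exact: continuous_coord. Qed.

Let mG : measurable_fun setT (G : borel_rV R n -> R).
Proof.
apply: (measurableT_comp (measurable_powR alpha)); apply: measurable_maxr => //.
by apply: continuous_measurable_borelR; exact: continuous_dotv.
Qed.

Let mN : measurable_fun setT (N : borel_rV R n -> R).
Proof.
apply: measurable_sum => i; apply: (measurableT_comp (measurable_powR alpha)).
by apply: measurableT_comp.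
Qed.

Let mg : measurable_fun setT (g : borel_rV R n -> R).
Proof.
apply: (measurableT_comp (measurable_powR alpha)); apply: measurable_maxr => //.
apply: measurable_sum => i; apply: measurable_funM => //.
apply: measurable_funB; apply: (measurableT_comp (measurable_powR alpha^-1)).
  exact: measurable_maxr.
by apply: measurable_maxr => //; exact: measurableT_comp.
Qed.

Let mnorm1 : measurable_fun setT (@norm1 R n : borel_rV R n -> R).
Proof. by apply: continuous_measurable_borelR; exact: continuous_norm1. Qed.

Let G_gt1 z : (1 < dotv xi z) = (1 < G z).
Proof.
have p0 : 0 <= pospart (dotv xi z) by rewrite le_max lexx orbT.
have -> : (1 < dotv xi z) = (1 < pospart (dotv xi z)).
  by rewrite /pospart lt_max ltr10 orbF.
have -> : (1 < G z) = (1 `^ alpha < G z) by rewrite powR1.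
rewrite /G; apply/idP/idP => h.
  by apply: gt0_ltr_powR => //; rewrite nnegrE.
rewrite ltNge; apply/negP => h'; move: h; rewrite ltNge; apply/negP/negPn.
by apply: ge0_ler_powR => //; rewrite ?nnegrE// ltW.
Qed.

Let N_gt0 z : 1 < dotv xi z -> 0 < N z.
Proof.
move=> /(dotv_away ltr01)[i zi]; have x0 := norm1_ge0 xi.
rewrite /N (bigD1 i)//=; apply: ltr_pwDl.
  by apply: powR_gt0; apply: lt_le_trans zi; rewrite divr_gt0//; lra.
by apply: sumr_ge0 => j _; exact: powR_ge0.
Qed.

Let measurable_sphere : measurable (@sphere1 R n : set (borel_rV R n)).
Proof.
have -> : @sphere1 R n = [set s | norm1 s <= 1] `&` [set s | 1 <= norm1 s].
  by apply/seteqP; split=> s /= => [->//|[h1 h2]]; apply/eqP; rewrite eq_le h1.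
by apply: measurableI; apply: measurable_le_fun.
Qed.

Section discretization.
Variable dl : R.
Hypothesis dl_gt0 : 0 < dl.

Let D (k : nat) : set 'rV[R]_n :=
  @sphere1 R n `&` ([set s | k%:R * dl <= g s] `&` [set s | g s < k.+1%:R * dl]).

Let K (k : nat) : set 'rV[R]_n :=
  [set z | k%:R * dl * N z <= G z] `&` [set z | G z < k.+1%:R * dl * N z].

Let E (k : nat) : set 'rV[R]_n := halfspace xi 1 `&` K k.

Let mD k : measurable (D k : set (borel_rV R n)).
Proof.
apply: measurableI; last apply: measurableI.
- exact: measurable_sphere.
- exact: measurable_le_fun.
- exact: measurable_lt_fun.
Qed.

Let mK k : measurable (K k : set (borel_rV R n)).
Proof.
apply: measurableI.
- by apply: measurable_le_fun => //; exact: measurable_funM.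
- by apply: measurable_lt_fun => //; exact: measurable_funM.
Qed.

Let mE k : measurable (E k : set (borel_rV R n)).
Proof. by apply: measurableI; [exact: measurable_halfspace|exact: mK]. Qed.

(* [D k] are the level sets of g on the sphere, [K k] the cones over them. *)
Let nu_cone (k : nat) (r : R) : 0 < r ->
  nu (@emb R n @` ([set z | r * b < N z] `&` K k)) = (r^-1%:E * Psi (D k))%E.
Proof.
move=> r0; rewrite -Psi_spec//; last by move=> s [].
congr (nu (_ @` _)); apply/seteqP; split=> [z [rz [z1 z2]]|_ [y [ry [_ [y1 y2]]] <-]].
  have [y yz] := T_surj z; exists y => //.
  move: rz z1 z2; rewrite -yz /= N_T G_T mulrC ltr_pM2l// => ry.
  have y0 : 0 < norm1 y by exact: lt_trans ry.
  rewrite (mulrCA (k%:R * dl)) (mulrCA (k.+1%:R * dl)) (ler_pM2l b_gt0) (ltr_pM2l b_gt0) => y1 y2.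
  split; first exact: ry.
  split.
    by rewrite /sphere1/= norm1Z ger0_norm ?invr_ge0 ?(ltW y0)// mulVf// gt_eqF.
  by split; rewrite /= gZ ?invr_ge0 ?(ltW y0)// [_^-1 * _]mulrC
    ?(ler_pdivlMr _ _ y0) ?(ltr_pdivrMr _ _ y0).
have y0 : 0 < norm1 y by exact: lt_trans ry.
move: y1 y2; rewrite /= gZ ?invr_ge0 ?(ltW y0)// [_^-1 * _]mulrC.
rewrite (ler_pdivlMr _ _ y0) (ltr_pdivrMr _ _ y0).
move=> y1 y2; split; first by rewrite /= N_T mulrC ltr_pM2l.
split; rewrite /= N_T G_T.
  by rewrite (mulrCA (k%:R * dl)) (ler_pM2l b_gt0).
by rewrite (mulrCA (k.+1%:R * dl)) (ltr_pM2l b_gt0).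
Qed.

(** The half-space is [1 < G z]. On [K k] this forces [N z > 1 / (k.+1 * dl)], and it follows from
    [N z > 1 / (k * dl)]; thus [E k] lies between two truncated cones, whose masses [nu_cone]
    gives. *)
Let nuE_le k : (nu (@emb R n @` E k) <= (b * (k.+1%:R * dl))%:E * Psi (D k))%E.
Proof.
have kd : 0 < k.+1%:R * dl by rewrite mulr_gt0.
have r0 : 0 < (b * (k.+1%:R * dl))^-1 by rewrite invr_gt0 mulr_gt0.
rewrite -[X in (_ <= X%:E * _)%E]invrK -nu_cone//; apply: le_measure; rewrite ?inE.
- apply: measurable_emb; exact: mE.
- apply: measurable_emb; apply: measurableI; last exact: mK.
  exact: measurable_lt_fun.
- apply: image_subset => z [z1 [z2 z3]]; split; last by split.
  rewrite /= invfM mulrAC mulVf ?gt_eqF// mul1r -div1r ltr_pdivrMr// mulrC.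
  by apply: lt_trans z3; rewrite -G_gt1.
Qed.

Let nuE_ge k : ((b * (k%:R * dl))%:E * Psi (D k) <= nu (@emb R n @` E k))%E.
Proof.
(* At level 0 there is no inner cone, its radius [1 / (k * dl)] being infinite, but the bound to
   prove is 0. *)
have [->|k0] := eqVneq k 0%N; first by rewrite mul0r mulr0 mul0e.
have kd : 0 < k%:R * dl by rewrite mulr_gt0// ltr0n lt0n.
have r0 : 0 < (b * (k%:R * dl))^-1 by rewrite invr_gt0 mulr_gt0.
rewrite -[X in (X%:E * _ <= _)%E]invrK -nu_cone//; apply: le_measure; rewrite ?inE.
- apply: measurable_emb; apply: measurableI; last exact: mK.
  exact: measurable_lt_fun.
- apply: measurable_emb; exact: mE.
- apply: image_subset => z [z1 [z2 z3]]; split; last by split.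
  move: z1; rewrite /= invfM mulrAC mulVf ?gt_eqF// mul1r -div1r ltr_pdivrMr// mulrC.
  by rewrite /halfspace/= G_gt1 => z1; exact: lt_le_trans z2.
Qed.

Let trivE : trivIset setT (fun k => @emb R n @` E k : set (borel_erV R n)).
Proof.
apply/trivIsetP => i j _ _ ij; apply/seteqP; split=> // _ [[x [h1 [x1 x2]] <-]].
move=> [y [_ [y1 y2]] /emb_inj yx]; subst y.
have Nx := N_gt0 h1.
have : (j < i.+1)%N by rewrite -(ltr_nat R) -(ltr_pM2r dl_gt0) -(ltr_pM2r Nx) (le_lt_trans y1).
have : (i < j.+1)%N by rewrite -(ltr_nat R) -(ltr_pM2r dl_gt0) -(ltr_pM2r Nx) (le_lt_trans x1).
by move=> h2 h3; move/eqP: ij; apply; apply/eqP;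
  rewrite eqn_leq -[(i <= j)%N]ltnS -[(j <= i)%N]ltnS h2 h3.
Qed.

Let bigcupE : \bigcup_k (@emb R n @` E k) = @emb R n @` halfspace xi 1.
Proof.
rewrite -image_bigcup; congr (_ @` _); apply/seteqP; split=> [z [k _ []//]|z hz].
have Nz := N_gt0 hz.
have q0 : 0 <= G z / (dl * N z) by rewrite divr_ge0 ?powR_ge0// mulr_ge0 ?ltW.
have /andP[k1 k2] := truncn_itv q0.
have dN : 0 < dl * N z by rewrite mulr_gt0.
exists (Num.truncn (G z / (dl * N z))) => //; split=> //.
split; rewrite /= -mulrA; first by rewrite -(ler_pdivlMr _ _ dN).
by rewrite -(ltr_pdivrMr _ _ dN).
Qed.

Let trivD : trivIset setT D.
Proof.
apply/trivIsetP => i j _ _ ij; apply/seteqP; split=> // s [[_ [x1 x2]] [_ [y1 y2]]].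
have : (j < i.+1)%N by rewrite -(ltr_nat R) -(ltr_pM2r dl_gt0) (le_lt_trans y1).
have : (i < j.+1)%N by rewrite -(ltr_nat R) -(ltr_pM2r dl_gt0) (le_lt_trans x1).
by move=> h2 h3; move/eqP: ij; apply; apply/eqP;
  rewrite eqn_leq -[(i <= j)%N]ltnS -[(j <= i)%N]ltnS h2 h3.
Qed.

Let bigcupD : \bigcup_k D k = @sphere1 R n.
Proof.
apply/seteqP; split=> [s [k _ []//]|s hs].
have q0 : 0 <= g s / dl by rewrite divr_ge0 ?g_ge0// ltW.
have /andP[k1 k2] := truncn_itv q0.
exists (Num.truncn (g s / dl)) => //; split=> //.
split; first by rewrite /= -(ler_pdivlMr _ _ dl_gt0).
by rewrite /= -(ltr_pdivrMr _ _ dl_gt0).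
Qed.

Let intD k :
  ((k%:R * dl)%:E * Psi (D k) <= \int[Psi]_(s in D k) (g s)%:E)%E /\
  (\int[Psi]_(s in D k) (g s)%:E <= (k.+1%:R * dl)%:E * Psi (D k))%E.
Proof.
have mgD : measurable_fun (D k : set (borel_rV R n)) (EFin \o g).
  by apply/measurable_EFinP; exact: measurable_funTS.
rewrite -!(integral_cst Psi (mD k)); split.
- apply: (ge0_le_integral Psi (mD k) _ _ mgD).
  + by move=> s _; rewrite lee_fin mulr_ge0// ltW.
  + exact: measurable_cst.
  + by move=> s [_ [h _]]; rewrite lee_fin.
- apply: (ge0_le_integral Psi (mD k) _ mgD).
  + by move=> s _; rewrite lee_fin.
  + exact: measurable_cst.
  + by move=> s [_ [_ h]]; rewrite lee_fin ltW.
Qed.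

Let I := (\int[Psi]_(s in @sphere1 R n) (g s)%:E)%E.

Let IE : I = (\sum_(k <oo) \int[Psi]_(s in D k) (g s)%:E)%E.
Proof.
rewrite /I -bigcupD ge0_integral_bigcup//.
- by apply/measurable_EFinP; exact: measurable_funTS.
- by move=> s _; rewrite lee_fin.
Qed.

Let nuhE : nu (@emb R n @` halfspace xi 1) = (\sum_(k <oo) nu (@emb R n @` E k))%E.
Proof.
rewrite -bigcupE measure_semi_bigcup//.
- by move=> k; apply: measurable_emb; exact: mE.
- by apply: bigcupT_measurable => k; apply: measurable_emb; exact: mE.
Qed.

Let PsiE : Psi (@sphere1 R n) = (\sum_(k <oo) Psi (D k))%E.
Proof.
rewrite -bigcupD measure_semi_bigcup//; exact: bigcupT_measurable.
Qed.

Let int_ge0 k : (0 <= \int[Psi]_(s in D k) (g s)%:E)%E.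
Proof. by apply: integral_ge0 => s _; rewrite lee_fin. Qed.

Let bint_ge0 k : (0 <= b%:E * \int[Psi]_(s in D k) (g s)%:E)%E.
Proof. by apply: mule_ge0; [rewrite lee_fin ltW|exact: int_ge0]. Qed.

Let bPsi_ge0 k : (0 <= (b * dl)%:E * Psi (D k))%E.
Proof. by apply: mule_ge0; [rewrite lee_fin mulr_ge0// ltW|exact: measure_ge0]. Qed.

Let split_step k : ((b * (k.+1%:R * dl))%:E * Psi (D k) =
  (b * (k%:R * dl))%:E * Psi (D k) + (b * dl)%:E * Psi (D k))%E.
Proof.
have d0 := ltW dl_gt0; have b0 := ltW b_gt0.
rewrite -natr1 mulrDl mul1r mulrDr EFinD ge0_muleDl// lee_fin.
  by rewrite mulr_ge0// mulr_ge0.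
by rewrite mulr_ge0.
Qed.

Let seriesE : (b%:E * I + (b * dl)%:E * Psi (@sphere1 R n) =
  \sum_(k <oo) (b%:E * \int[Psi]_(s in D k) (g s)%:E + (b * dl)%:E * Psi (D k)))%E.
Proof.
rewrite IE PsiE -nneseriesZl; last by move=> k _; exact: int_ge0.
rewrite -nneseriesZl; last by move=> k _; exact: measure_ge0.
rewrite -nneseriesD//.
Qed.

(** On each level [nu (E k)] and [b] times the integral of g over [D k] lie in the same interval, of
    length [b * dl * Psi (D k)]. Summing over the levels bounds the total error by
    [b * dl * Psi sphere1], which tends to 0 with [dl] because [Psi] is finite. *)
Lemma spectral_ub : (nu (@emb R n @` halfspace xi 1) <=
  b%:E * I + (b * dl)%:E * Psi (@sphere1 R n))%E.
Proof.
rewrite seriesE nuhE; apply: lee_nneseries => [k _ _|k _]; first exact: measure_ge0.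
apply: (le_trans (nuE_le k)); rewrite split_step leeD2r//.
rewrite EFinM -muleA lee_pmul2l ?lte_fin//.
by have [] := intD k.
Qed.

Lemma spectral_lb : (b%:E * I <=
  nu (@emb R n @` halfspace xi 1) + (b * dl)%:E * Psi (@sphere1 R n))%E.
Proof.
rewrite IE nuhE PsiE -nneseriesZl; last by move=> k _; exact: int_ge0.
rewrite -nneseriesZl; last by move=> k _; exact: measure_ge0.
rewrite -nneseriesD//; apply: lee_nneseries => [k _ _|k _]; first exact: bint_ge0.
apply: (@le_trans _ _ (b%:E * ((k.+1%:R * dl)%:E * Psi (D k)))%E).
  by rewrite lee_pmul2l ?lte_fin//; have [] := intD k.
by rewrite muleA -EFinM split_step leeD2r.
Qed.

End discretization.

Hypothesis mass_fin : nu (@emb R n @` halfspace xi 1) = (half_mass nu xi)%:E.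

Lemma spectral_integral :
  (\int[Psi]_(s in @sphere1 R n) (gfun xi alpha s)%:E = (half_mass nu xi / b)%:E)%E.
Proof.
set I := (\int[Psi]_(s in _) _)%E.
have b0 := b_gt0.
have Ps0 : 0 <= fine (Psi (@sphere1 R n)) by rewrite fine_ge0.
have PsE : Psi (@sphere1 R n) = (fine (Psi (@sphere1 R n)))%:E.
  by rewrite fineK// fin_num_measure//; exact: measurable_sphere.
have small (e : R) : 0 < e -> exists2 dl, 0 < dl &
    ((b * dl)%:E * Psi (@sphere1 R n) <= e%:E)%E.
  move: Ps0; rewrite PsE /=; move: (fine _) => p p0 e0.
  have bp0 : 0 < b * (p + 1) by rewrite mulr_gt0//; lra.
  exists (e / (b * (p + 1))); first by rewrite divr_gt0.
  have := divfK (lt0r_neq0 bp0) e; have : 0 < e / (b * (p + 1)) by rewrite divr_gt0.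
  move: (e / _) => dl dl0 dlE; rewrite -EFinM lee_fin -[leRHS]dlE.
  by have : 0 < dl * b by [rewrite mulr_gt0]; lra.
have bI : (b%:E * I = (half_mass nu xi)%:E)%E.
  apply/eqP; rewrite eq_le -mass_fin; apply/andP; split; apply/lee_addgt0Pr => e e0;
    have [dl dl0 dlP] := small e e0.
    by apply: le_trans (spectral_lb dl0) _; rewrite leeD2l.
  by apply: le_trans (spectral_ub dl0) _; rewrite leeD2l.
by rewrite mulrC EFinM -bI muleA -EFinM mulVf ?gt_eqF// mul1e.
Qed.

End spectral.

(** * Tails as functions of a real threshold *)

Definition tailf d (T : measurableType d) (R : realType) (P : probability T R)
  (U : T -> R) (t : R) : R := fine (P [set w | t < U w]).

(** Everything the comparison takes from multivariate regular variation: the limit constant is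
    already the spectral integral, and neither [nu] nor the normalizing sequence appears from here
    on. The dimension is [n.+1] so that a first coordinate exists. *)
Lemma portfolio_tail (R : realType) (n : nat) (d : measure_display)
    (T : measurableType d) (P : probability T R) (X : T -> 'rV[R]_n.+1) (alpha : R)
    (Psi : {finite_measure set (borel_rV R n.+1) -> \bar R}) :
  0 < alpha -> measurable_fun setT (X : T -> borel_rV R n.+1) ->
  canonical_spectral P alpha X Psi -> balanced_tails P X ->
  let F := tailf P (fun w => `|X w ord0 ord0|) in
  [/\ forall t, 0 < F t,
      forall l, 0 < l -> F (l * t) / F t @[t --> +oo] --> l `^ (- alpha) &
      forall xi : 'rV[R]_n.+1, exists2 c : R,
        (\int[Psi]_(s in @sphere1 R n.+1) (gfun xi alpha s)%:E = c%:E)%E &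
        tailf P (fun w => dotv xi (X w)) t / F t @[t --> +oo] --> c].
Proof.
move=> a0 mX [_ [nu [nuX B0 spec]]] bal F; split.
- exact: (abs_tail_gt0 a0 nuX mX (B0 ord0)).
- move=> l l0; exact: (abs_tail_regular a0 nuX mX (B0 ord0) l0).
- move=> xi; exists (half_mass nu xi / abs_mass nu ord0).
    apply: (spectral_integral a0 (abs_mass_gt0 nuX (B0 ord0)) _ spec).
      by move=> i; exact: (balanced_abs_mass i a0 nuX mX (B0 ord0) bal).
    by rewrite (half_massE nuX)// powR1 mul1r.
  exact: (dot_tail_ratio_cvg a0 nuX mX (B0 ord0)).
Qed.

Section limsup.
Variable R : realType.
Implicit Types (f : R -> \bar R).

Lemma limf_esup_lt_near f (y : \bar R) : (limf_esup f (pinfty_nbhs R) < y)%E ->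
  \forall t \near +oo, (f t < y)%E.
Proof.
rewrite limf_esupE => /ereal_inf_lt[_ [V VF <-]] h.
apply: filterS VF => t Vt; apply: le_lt_trans h; apply: ereal_sup_ubound.
by exists t.
Qed.

Lemma near_limf_esup_le f (y : \bar R) : (\forall t \near +oo, (f t <= y)%E) ->
  (limf_esup f (pinfty_nbhs R) <= y)%E.
Proof.
move=> fy; rewrite limf_esupE.
apply: (@le_trans _ _ (ereal_sup (f @` [set t | (f t <= y)%E]))).
  by apply: ereal_inf_lbound; exists [set t | (f t <= y)%E].
by apply: ge_ereal_sup => _ [t /= ty <-].
Qed.

End limsup.

Lemma measurable_gt_fun d (T : measurableType d) (R : realType) (U : T -> R) (t : R) :
  measurable_fun setT U -> measurable [set w | t < U w].
Proof. by move=> mU; exact: measurable_lt_fun. Qed.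

Lemma tailfE d (T : measurableType d) (R : realType) (P : probability T R)
    (U : T -> R) (t : R) : measurable_fun setT U ->
  P [set w | t < U w] = (tailf P U t)%:E.
Proof.
by move=> mU; rewrite /tailf fineK// fin_num_measure//; exact: measurable_gt_fun.
Qed.

Lemma tailf_ge0 d (T : measurableType d) (R : realType) (P : probability T R)
    (U : T -> R) (t : R) : 0 <= tailf P U t.
Proof. by rewrite fine_ge0. Qed.

Lemma integral_ccdf d (T : measurableType d) (R : realType) (P : probability T R)
    (U : T -> R) : measurable_fun setT U -> (forall w, 0 <= U w) ->
  (\int[P]_w (U w)%:E =
   \int[@lebesgue_measure R]_(r in `[0%R, +oo[) P [set w | (r < U w)%R])%E.
Proof.
move=> mU U0; pose V : {RV P >-> R} := mfun_Sub (mem_set mU).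
have := @ge0_expectation_ccdf _ _ _ P V U0.
rewrite unlock => ->; apply: eq_integral => r _.
rewrite /ccdf /distribution /pushforward; congr (P _).
by apply/seteqP; split=> w /=; rewrite in_itv/= andbT.
Qed.

(* Both means are the integrals of their tails over the positive half-line. *)
Lemma le_integral_tail d1 d2 (T1 : measurableType d1) (T2 : measurableType d2)
    (R : realType) (P1 : probability T1 R) (P2 : probability T2 R)
    (U : T1 -> R) (V : T2 -> R) (c : R) :
  measurable_fun setT U -> measurable_fun setT V ->
  (forall w, 0 <= U w) -> (forall w, 0 <= V w) -> 0 <= c ->
  (forall r, 0 <= r -> tailf P1 U r <= c * tailf P2 V r) ->
  (\int[P1]_w (U w)%:E <= c%:E * \int[P2]_w (V w)%:E)%E.
Proof.
move=> mU mV U0 V0 c0 UV; rewrite !integral_ccdf//.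
have mt d (T : measurableType d) (P : probability T R) (W : T -> R) :
    measurable_fun setT W ->
    measurable_fun (`[0, +oo[%classic : set (measurableTypeR R))
      (fun r : R => P [set w | (r < W w)%R]).
  move=> mW; apply: measurable_funTS.
  pose V' : {RV P >-> R} := mfun_Sub (mem_set mW).
  have := ccdf_measurable V'; congr measurable_fun; apply/funext => r.
  rewrite /ccdf /distribution /pushforward; congr (P _).
  by apply/seteqP; split=> w /=; rewrite in_itv/= andbT.
rewrite -ge0_integralZl//; last exact: mt.
apply: ge0_le_integral => //; first exact: mt.
  by apply: measurable_funeM; exact: mt.
by move=> r /=; rewrite in_itv/= andbT => r0; rewrite !tailfE// -EFinM lee_fin UV.
Qed.

(** * Excess means *)

Section excess.
Variables (d : measure_display) (T : measurableType d) (R : realType).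
Variable P : probability T R.
Implicit Types (V : T -> R) (u l m t : R).

Lemma hfun_ge0 u t : 0 <= hfun u t.
Proof. by rewrite /hfun /pospart le_max lexx orbT. Qed.

Lemma measurable_hfun V u : measurable_fun setT V ->
  measurable_fun setT (fun w => hfun u (V w)).
Proof.
move=> mV; apply: measurable_maxr; last exact: measurable_cst.
by apply: measurable_funB => //; exact: measurable_cst.
Qed.

Definition excess V u : \bar R := (\int[P]_w (hfun u (V w))%:E)%E.

Lemma excess_ge0 V u : (0 <= excess V u)%E.
Proof. by apply: integral_ge0 => w _; rewrite lee_fin hfun_ge0. Qed.

Lemma tailf_hfun V u r : 0 <= r -> tailf P (fun w => hfun u (V w)) r = tailf P V (u + r).
Proof.
move=> r0; congr (fine (P _)); apply/seteqP; split=> w /=.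
  by rewrite /hfun /pospart lt_max => /orP[]; lra.
by rewrite /hfun /pospart lt_max => h; apply/orP; left; lra.
Qed.

(** Pointwise, lowering the level from [l * u] to [u] raises [(v - u)_+] by at most [(l - 1) * u],
    and only where [v > u]; the raise is the full [(l - 1) * u] where [v > l * u], which gives the
    companion lower bound. *)
Lemma excess_step_ub V u l : measurable_fun setT V -> 0 < u -> 1 < l ->
  (excess V u <= excess V (l * u) + ((l - 1) * u * tailf P V u)%:E)%E.
Proof.
move=> mV u0 l1; have lu0 : 0 <= (l - 1) * u by rewrite mulr_ge0; lra.
rewrite EFinM -tailfE// /excess -ge0_integralD_indic//; last 3 first.
- exact: measurable_hfun.
- by move=> w; exact: hfun_ge0.
- exact: measurable_gt_fun.
apply: ge0_le_integral; first exact: measurableT.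
- by move=> w _; rewrite lee_fin hfun_ge0.
- by apply/measurable_EFinP; exact: measurable_hfun.
- apply/measurable_EFinP; apply: measurable_funD; first exact: measurable_hfun.
  apply: measurable_funM; first exact: measurable_cst.
  by apply: measurable_indic; exact: measurable_gt_fun.
- move=> w _; rewrite lee_fin; have [h|h] := leP (V w) u.
    have -> : hfun u (V w) = 0 by rewrite /hfun /pospart max_r//; lra.
    by rewrite addr_ge0 ?hfun_ge0// mulr_ge0.
  rewrite (@indic_in _ _ [set w | u < V w])// mulr1 /hfun /pospart.
  rewrite ge_max -lerBlDr le_max; apply/andP; split; first by apply/orP; left; nra.
  by rewrite -lerBlDr le_max; apply/orP; right; lra.
Qed.

Lemma excess_step_lb V u l : measurable_fun setT V -> 0 < u -> 1 < l ->
  (excess V (l * u) + ((l - 1) * u * tailf P V (l * u))%:E <= excess V u)%E.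
Proof.
move=> mV u0 l1; have lu0 : 0 <= (l - 1) * u by rewrite mulr_ge0; lra.
rewrite EFinM -tailfE// /excess -ge0_integralD_indic//; last 3 first.
- exact: measurable_hfun.
- by move=> w; exact: hfun_ge0.
- exact: measurable_gt_fun.
apply: ge0_le_integral; first exact: measurableT.
- by move=> w _; rewrite lee_fin addr_ge0 ?hfun_ge0// mulr_ge0.
- apply/measurable_EFinP; apply: measurable_funD; first exact: measurable_hfun.
  apply: measurable_funM; first exact: measurable_cst.
  by apply: measurable_indic; exact: measurable_gt_fun.
- by apply/measurable_EFinP; exact: measurable_hfun.
- move=> w _; rewrite lee_fin; have [h|h] := leP (V w) (l * u).
    rewrite indic_notin /=; last by apply/negP; rewrite -leNgt.
    have -> : hfun (l * u) (V w) = 0 by rewrite /hfun /pospart max_r//; lra.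
    by rewrite mulr0 addr0 hfun_ge0.
  rewrite (@indic_in _ _ [set w | l * u < V w])// mulr1 /hfun /pospart.
  by rewrite max_l; [rewrite le_max; apply/orP; left|]; lra.
Qed.

(** The change of variable behind the factor [l] is made on the random variable: the tail of
    [l * hfun u V] at [r] is that of [V] at [u + r / l], and [l * u + r = l * (u + r / l)]. Only
    tails then have to be compared. *)
Lemma excess_scale_ub V u l m : measurable_fun setT V -> 0 < u -> 1 < l -> 0 <= m ->
  (forall t, u <= t -> tailf P V (l * t) <= m * tailf P V t) ->
  (excess V (l * u) <= (l * m)%:E * excess V u)%E.
Proof.
move=> mV u0 l1 m0 tV; have l0 : 0 < l by lra.
have mh := measurable_hfun u mV.
have -> : ((l * m)%:E * excess V u = m%:E * \int[P]_w (l * hfun u (V w))%:E)%E.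
  rewrite mulrC EFinM -muleA /excess -ge0_integralZl//.
  - by apply/measurable_EFinP.
  - by move=> w _; rewrite lee_fin hfun_ge0.
  - by rewrite lee_fin ltW.
apply: le_integral_tail => //.
- exact: measurable_hfun.
- by apply: measurable_funM => //; exact: measurable_cst.
- by move=> w; exact: hfun_ge0.
- by move=> w; rewrite mulr_ge0 ?hfun_ge0// ltW.
move=> r r0; rewrite tailf_hfun//.
have -> : tailf P (fun w => l * hfun u (V w)) r = tailf P V (u + r / l).
  rewrite -tailf_hfun ?divr_ge0 ?(ltW l0)//; congr (fine (P _)).
  by apply/seteqP; split=> w /=; rewrite ltr_pdivrMr// mulrC.
have -> : l * u + r = l * (u + r / l) by rewrite mulrDr [l * (_ / _)]mulrC divfK// gt_eqF.
by apply: tV; rewrite lerDl divr_ge0// ltW.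
Qed.

Lemma excess_scale_lb V u l m : measurable_fun setT V -> 0 < u -> 1 < l -> 0 < m ->
  (forall t, u <= t -> m * tailf P V t <= tailf P V (l * t)) ->
  ((l * m)%:E * excess V u <= excess V (l * u))%E.
Proof.
move=> mV u0 l1 m0 tV; have l0 : 0 < l by lra.
have mh := measurable_hfun u mV.
suff : (l%:E * excess V u <= m^-1%:E * excess V (l * u))%E.
  rewrite [l * m]mulrC EFinM -muleA => h.
  apply: (@le_trans _ _ (m%:E * (m^-1%:E * excess V (l * u)))%E).
    by apply: lee_wpmul2l => //; rewrite lee_fin ltW.
  by rewrite muleA -EFinM mulfV ?mul1e// gt_eqF.
have -> : (l%:E * excess V u = \int[P]_w (l * hfun u (V w))%:E)%E.
  rewrite /excess -ge0_integralZl//.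
  - by apply/measurable_EFinP.
  - by move=> w _; rewrite lee_fin hfun_ge0.
  - by rewrite lee_fin ltW.
apply: le_integral_tail.
- by apply: measurable_funM => //; exact: measurable_cst.
- exact: measurable_hfun.
- by move=> w; rewrite mulr_ge0 ?hfun_ge0// ltW.
- by move=> w; exact: hfun_ge0.
- by rewrite invr_ge0 ltW.
move=> r r0; rewrite [X in _ <= _ * X]tailf_hfun//.
have -> : tailf P (fun w => l * hfun u (V w)) r = tailf P V (u + r / l).
  rewrite -tailf_hfun ?divr_ge0 ?(ltW l0)//; congr (fine (P _)).
  by apply/seteqP; split=> w /=; rewrite ltr_pdivrMr// mulrC.
have -> : l * u + r = l * (u + r / l) by rewrite mulrDr [l * (_ / _)]mulrC divfK// gt_eqF.
by rewrite -ler_pdivrMl ?invr_gt0// invrK; apply: tV; rewrite lerDl divr_ge0// ltW.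
Qed.

End excess.

Section karamata.
Variables (d : measure_display) (T : measurableType d) (R : realType).
Variable P : probability T R.
Implicit Types (V : T -> R) (u l m t : R).

Lemma hfun_le u s t : s <= t -> hfun u s <= hfun u t.
Proof.
move=> st; rewrite /hfun /pospart ge_max !le_max lexx orbT andbT.
by apply/orP; left; lra.
Qed.

Lemma excess_cvg_min V u : measurable_fun setT V ->
  excess P (fun w => Num.min (V w) k%:R) u @[k --> \oo] --> excess P V u.
Proof.
move=> mV; pose g k w := (hfun u (Num.min (V w) k%:R))%:E.
have glim w : limn (g ^~ w) = (hfun u (V w))%:E.
  apply/cvg_lim => //; apply: cvg_near_cst; near=> k; rewrite /g min_l//.
  by near: k; exact: nbhs_infty_ger.
rewrite /excess; under [X in _ --> X]eq_integral do rewrite -glim.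
apply: cvg_monotone_convergence => //.
- move=> k; apply/measurable_EFinP; apply: measurable_hfun.
  by apply: measurable_minr => //; exact: measurable_cst.
- by move=> k w _; rewrite lee_fin hfun_ge0.
- move=> w _ i j ij; rewrite lee_fin hfun_le//.
  by rewrite le_min !ge_min lexx/= ler_nat ij orbT.
Unshelve. all: by end_near. Qed.

Lemma tailf_min V (M t : R) :
  tailf P (fun w => Num.min (V w) M) t = if t < M then tailf P V t else 0.
Proof.
case: ifPn => tM.
  by congr (fine (P _)); apply/seteqP; split=> w /=; rewrite lt_min tM andbT.
rewrite /tailf (_ : [set w | _] = set0) ?measure0//.
by apply/seteqP; split=> w //=; rewrite lt_min (negPf tM) andbF.
Qed.

(* Truncating [V] makes its excess finite, so that the inequality
   e <= l * m * e + (l - 1) * u * tail can be solved for e. *)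
Lemma excess_karamata_ub V u l m : measurable_fun setT V -> 0 < u -> 1 < l ->
  0 <= m -> l * m < 1 ->
  (forall t, u <= t -> tailf P V (l * t) <= m * tailf P V t) ->
  (excess P V u <= ((l - 1) * u * tailf P V u / (1 - l * m))%:E)%E.
Proof.
move=> mV u0 l1 m0 lm tV.
have mVk k : measurable_fun setT (fun w => Num.min (V w) k%:R).
  by apply: measurable_minr => //; exact: measurable_cst.
apply: (cvge_le _ (excess_cvg_min mV)); apply: nearW => k.
pose Vk w := Num.min (V w) k%:R.
have fin : (excess P Vk u <= k%:R%:E)%E.
  rewrite /excess -[leRHS]mule1 -(@probability_setT _ _ _ P) -(integral_cst P measurableT).
  apply: ge0_le_integral; first exact: measurableT.
  - by move=> w _; rewrite lee_fin hfun_ge0.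
  - by apply/measurable_EFinP; apply: measurable_hfun; exact: mVk.
  - exact: measurable_cst.
  - move=> w _; rewrite lee_fin /hfun /pospart ge_max ler0n andbT.
    by rewrite lerBlDr ge_min; apply/orP; right; rewrite lerDl ltW.
have eE : excess P Vk u = (fine (excess P Vk u))%:E.
  rewrite fineK// ge0_fin_numE ?excess_ge0//.
  by rewrite (le_lt_trans fin) ?ltry.
have h1 := excess_step_ub P (mVk k) u0 l1.
have h2 : (excess P Vk (l * u) <= (l * m)%:E * excess P Vk u)%E.
  (* Truncation preserves this tail inequality: as [t < l * t], the left side is cut to 0 no later
     than the right one. *)
  apply: (excess_scale_ub (mVk k)) => // t ut; rewrite !tailf_min.
  have t0 : 0 < t by lra.
  have tl : t < l * t by rewrite ltr_pMl.
  case: ifPn => h; first by rewrite (lt_trans tl)// tV.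
  by case: ifP => _; rewrite ?mulr0// mulr_ge0 ?tailf_ge0.
have h3 : tailf P Vk u <= tailf P V u.
  by rewrite /Vk tailf_min; case: ifP => // _; exact: tailf_ge0.
have {h1} : (excess P Vk u <=
    (l * m)%:E * excess P Vk u + ((l - 1) * u * tailf P V u)%:E)%E.
  apply: (le_trans h1); apply: leeD h2 _; rewrite lee_fin ler_wpM2l//.
  by rewrite mulr_ge0; lra.
rewrite -/Vk eE -EFinM -EFinD !lee_fin => h.
rewrite ler_pdivlMr ?subr_gt0//; lra.
Qed.

(** Truncation would destroy the lower tail inequality when [t < k <= l * t], hence finiteness of
    the excess is assumed. It allows the term [l * m * e] to be moved across the inequality. *)
Lemma excess_karamata_lb V u l m (e : R) : measurable_fun setT V -> 0 < u -> 1 < l ->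
  0 < m -> excess P V u = e%:E ->
  (forall t, u <= t -> m * tailf P V t <= tailf P V (l * t)) ->
  (l - 1) * u * m * tailf P V u <= (1 - l * m) * e.
Proof.
move=> mV u0 l1 m0 eE tV.
have h1 := excess_step_lb P mV u0 l1.
have h2 := excess_scale_lb mV u0 l1 m0 tV.
have lu0 : 0 <= (l - 1) * u by rewrite mulr_ge0; lra.
have h3 : (l - 1) * u * (m * tailf P V u) <= (l - 1) * u * tailf P V (l * u).
  by rewrite ler_wpM2l// tV.
have : ((l * m)%:E * e%:E + ((l - 1) * u * (m * tailf P V u))%:E <= e%:E)%E.
  rewrite -eE; apply: le_trans h1; apply: leeD h2 _.
  by rewrite lee_fin.
rewrite -EFinM -EFinD lee_fin; lra.
Qed.

End karamata.

(** * Comparison of the constants for tail index above 1 *)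

Section regular.
Variables (R : realType) (F : R -> R) (alpha : R).
Hypothesis F0 : forall t, 0 < F t.
Hypothesis Freg : forall l, 0 < l -> F (l * t) / F t @[t --> +oo] --> l `^ (- alpha).

Lemma regular_near_ub l m : 0 < l -> l `^ (- alpha) < m ->
  \forall t \near +oo, F (l * t) <= m * F t.
Proof.
move=> l0 lm; apply: filterS (cvgr_le _ (Freg l0) _ lm) => t.
by rewrite ler_pdivrMr.
Qed.

Lemma regular_near_lb l m : 0 < l -> m < l `^ (- alpha) ->
  \forall t \near +oo, m * F t <= F (l * t).
Proof.
move=> l0 lm; apply: filterS (cvgr_ge _ (Freg l0) _ lm) => t.
by rewrite ler_pdivlMr.
Qed.

End regular.

Lemma ratio_near_ub (R : realType) (p F : R -> R) (c a : R) : (forall t, 0 < F t) ->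
  p t / F t @[t --> +oo] --> c -> c < a -> \forall t \near +oo, p t <= a * F t.
Proof.
move=> F0 pF ca; apply: filterS (cvgr_le _ pF _ ca) => t.
by rewrite ler_pdivrMr.
Qed.

Lemma ratio_near_lb (R : realType) (p F : R -> R) (c a : R) : (forall t, 0 < F t) ->
  p t / F t @[t --> +oo] --> c -> a < c -> \forall t \near +oo, a * F t <= p t.
Proof.
move=> F0 pF ca; apply: filterS (cvgr_ge _ pF _ ca) => t.
by rewrite ler_pdivlMr.
Qed.

Lemma near_pinfty_gtP (R : realType) (Q : R -> Prop) :
  (\forall t \near +oo, Q t) -> exists M : R, forall t, M < t -> Q t.
Proof. by move=> [M [_ h]]; exists M. Qed.

(* At [dl = 0] the last inequality is [a' * k < a * m * k]; it survives for
   [dl] small compared with the gap [k * (a * m - a')]. *)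
Lemma small_perturbation (R : realType) (a a' k l m : R) :
  0 < a -> 0 < a' -> 0 < k -> 0 < l -> 0 < m -> m < 1 -> a' < a * m ->
  exists dl, [/\ 0 < dl, dl < m, l * dl < k &
    a' * (k + l * dl) < a * (1 - dl) * (m - dl) * (k - l * dl)].
Proof.
move=> a0 a'0 k0 l0 m0 m1 aam.
(* [C] bounds the loss per unit of [dl]: the right side exceeds the left one by at least
   [g - dl * C], with [g] the gap at [dl = 0]. The choice [dl = g / (2 * C)] keeps half of the
   gap. *)
pose C := a * (m * k + k + l * m) + a' * l.
have mk0 : 0 < m * k by rewrite mulr_gt0.
have lm0 : 0 < l * m by rewrite mulr_gt0.
have C0 : 0 < C by rewrite addr_gt0 ?mulr_gt0//; lra.
pose g := k * (a * m - a').
have g0 : 0 < g by rewrite mulr_gt0//; lra.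
exists (g / (2 * C)).
have C2 : 0 < 2 * C by lra.
have := divfK (lt0r_neq0 C2) g; have : 0 < g / (2 * C) by rewrite divr_gt0.
move: (g / _) => dl dl0 dlE.
have gC : dl * C < g by lra.
have dlm : dl < m.
  rewrite -(ltr_pM2r C0) (lt_le_trans gC)//.
  have : 0 <= a' * (k + m * l) by rewrite mulr_ge0 ?addr_ge0 ?mulr_ge0 ?ltW.
  have : 0 <= a * m * (m * k + l * m) by rewrite !mulr_ge0 ?addr_ge0 ?mulr_ge0 ?ltW.
  by rewrite /g /C; lra.
have dlk : l * dl < k.
  rewrite -(ltr_pM2r C0) -mulrA.
  apply: (@lt_le_trans _ _ (l * g)); first by rewrite ltr_pM2l.
  have : 0 <= a' * k * l by rewrite !mulr_ge0 ?ltW.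
  have : 0 <= a * k * (m * k + k) by rewrite !mulr_ge0 ?addr_ge0 ?mulr_ge0 ?ltW.
  by rewrite /g /C; nra.
split=> //.
pose p := (1 - dl) * (m - dl).
have p1 : m - dl * (1 + m) <= p by rewrite /p; nra.
have p2 : p <= m by rewrite /p; nra.
have q1 : (m - dl * (1 + m)) * k <= p * k by rewrite ler_wpM2r// ltW.
have q2 : p * (l * dl) <= m * (l * dl) by rewrite ler_wpM2r//; apply: mulr_ge0; exact: ltW.
have h : (m * k - dl * (m * k + k + l * m)) * a <= p * (k - l * dl) * a.
  by rewrite ler_wpM2r ?(ltW a0)//; lra.
have -> : a * (1 - dl) * (m - dl) * (k - l * dl) = p * (k - l * dl) * a.
  by rewrite /p; ring.
by apply: lt_le_trans h; move: gC; rewrite /g /C; lra.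
Qed.

(** Parametrized by [m] because the caller prescribes how close to 1 the loss must be. With
    [m = l ^ (- alpha)] one has [l * m = l ^ (1 - alpha)], below 1 exactly because [alpha > 1]. *)
Lemma regular_scale (R : realType) (alpha m : R) : 1 < alpha -> 0 < m -> m < 1 ->
  exists l, [/\ 1 < l, l `^ (- alpha) = m & l * m < 1].
Proof.
move=> a1 m0 m1; have a0 : 0 < alpha by lra.
exists (m `^ (- alpha)^-1).
have lE : (m `^ (- alpha)^-1) `^ (- alpha) = m.
  by rewrite powRKV ?ltW// oppr_eq0 gt_eqF.
have l1 : 1 < m `^ (- alpha)^-1.
  rewrite invrN powRN invf_gt1 ?powR_gt0//.
  have -> : 1 = 1 `^ alpha^-1 :> R by rewrite powR1.
  apply: gt0_ltr_powR => //; rewrite ?invr_gt0 ?nnegrE//.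
  exact: ltW.
split=> //; move: lE l1; move: (_ `^ (- alpha)^-1) => l lE l1.
have l0 : 0 < l by lra.
rewrite -lE powRN ltr_pdivrMr ?powR_gt0// mul1r.
rewrite -(@mulr_powRB1 _ l alpha) ?ltW// ltr_pMr//.
suff : 1 `^ (alpha - 1) < l `^ (alpha - 1) by rewrite powR1.
apply: gt0_ltr_powR => //; rewrite ?subr_gt0 ?nnegrE//.
exact: ltW.
Qed.

Section order.
Variables (R : realType) (d1 d2 : measure_display).
Variables (T1 : measurableType d1) (T2 : measurableType d2).
Variables (P1 : probability T1 R) (P2 : probability T2 R).
Variables (U Z : T1 -> R) (V W : T2 -> R) (alpha cX cY : R).
Hypotheses (mU : measurable_fun setT U) (mZ : measurable_fun setT Z).
Hypotheses (mV : measurable_fun setT V) (mW : measurable_fun setT W).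
Let F := tailf P1 U.
Let G := tailf P2 V.
Hypotheses (F0 : forall t, 0 < F t) (G0 : forall t, 0 < G t).
Hypothesis Greg : forall l, 0 < l -> G (l * t) / G t @[t --> +oo] --> l `^ (- alpha).
Hypotheses (ZF : tailf P1 Z t / F t @[t --> +oo] --> cX).
Hypotheses (WG : tailf P2 W t / G t @[t --> +oo] --> cY).

Let cX0 : 0 <= cX.
Proof.
rewrite -(cvg_lim (@Rhausdorff R) ZF); apply: limr_ge; first by apply/cvg_ex; exists cX.
by apply: nearW => t; rewrite divr_ge0 ?tailf_ge0.
Qed.

Let cY0 : 0 <= cY.
Proof.
rewrite -(cvg_lim (@Rhausdorff R) WG); apply: limr_ge; first by apply/cvg_ex; exists cY.
by apply: nearW => t; rewrite divr_ge0 ?tailf_ge0.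
Qed.

Lemma excess_order (u0 : R) : 1 < alpha ->
  (forall l, 0 < l -> F (l * t) / F t @[t --> +oo] --> l `^ (- alpha)) ->
  (forall eta, eta < 1 -> ~ \forall t \near +oo, F t < eta * G t) ->
  (forall u, u0 <= u -> (excess P1 Z u <= excess P2 W u)%E) ->
  cX <= cY.
Proof.
move=> a1 Freg FG ZW; rewrite leNgt; apply/negP => cYX.
have cY0' := cY0.
pose a' := cY + (cX - cY) / 3; pose a := cX - (cX - cY) / 3.
have a'0 : 0 < a' by rewrite /a'; lra.
have a'a : a' < a by rewrite /a /a'; lra.
have a'cY : cY < a' by rewrite /a'; lra.
have acX : a < cX by rewrite /a; lra.
move: a a' a'0 a'a a'cY acX => a a' a'0 a'a a'cY acX.
have a0 : 0 < a by lra.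
(* The lower Karamata bound loses the factor [m], which must not consume the gap between [a'] and
   [a]; the witness makes [a * m] their midpoint. *)
have [m [m0 m1 am]] : exists m, [/\ 0 < m, m < 1 & a' < a * m].
  exists ((a + a') / (2 * a)); have a2 : 0 < 2 * a by lra.
  split; first by rewrite divr_gt0//; lra.
    by rewrite ltr_pdivrMr//; lra.
  rewrite mulrA ltr_pdivlMr//; nra.
have [l [l1 lm lm1]] := regular_scale a1 m0 m1.
have l0 : 0 < l by lra.
have k0 : 0 < 1 - l * m by lra.
have [dl [dl0 dlm dlk]] := small_perturbation a0 a'0 k0 l0 m0 m1 am.
set k1 := 1 - l * m + l * dl; set k2 := 1 - l * m - l * dl => contra.
have k20 : 0 < k2 by rewrite /k2; lra.
have near4 : \forall t \near +oo,
    [/\ a * F t <= tailf P1 Z t, tailf P2 W t <= a' * G t,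
        G (l * t) <= (m + dl) * G t & (m - dl) * F t <= F (l * t)].
  have h1 := ratio_near_lb F0 ZF acX.
  have h2 := ratio_near_ub G0 WG a'cY.
  have h3 : \forall t \near +oo, G (l * t) <= (m + dl) * G t.
    by apply: (regular_near_ub G0 Greg) => //; lra.
  have h4 : \forall t \near +oo, (m - dl) * F t <= F (l * t).
    by apply: (regular_near_lb F0 Freg) => //; lra.
  by near=> t; split; near: t.
have [M HM] := near_pinfty_gtP near4.
(* A single [u] is enough, since the other estimates hold at every threshold beyond [M]; the limsup
   hypothesis only provides arbitrarily large ones. *)
have [u [u1 u2 u3 FGu]] : exists u, [/\ M < u, 0 < u, u0 <= u & (1 - dl) * G u <= F u].
  apply: contrapT => /forallNP h; apply: (FG (1 - dl)); first lra.
  have h1 : \forall t \near +oo, M < t by apply: nbhs_pinfty_gt; exact: num_real.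
  have h2 : \forall t \near +oo, (0 : R) < t by apply: nbhs_pinfty_gt; exact: num_real.
  have h3 : \forall t \near +oo, u0 <= t by apply: nbhs_pinfty_ge; exact: num_real.
  near=> t; rewrite ltNge; apply/negP => FGt; apply: (h t).
  by split=> //; near: t.
have Vu : (excess P2 V u <= ((l - 1) * u * G u / k2)%:E)%E.
  have -> : k2 = 1 - l * (m + dl) by rewrite /k2; ring.
  apply: excess_karamata_ub => //.
  - by apply: addr_ge0; exact: ltW.
  - by move: k20; rewrite /k2; lra.
  - by move=> t ut; have [] := HM t (lt_le_trans u1 ut).
have Wu : (excess P2 W u <= a'%:E * excess P2 V u)%E.
  apply: le_integral_tail.
  - exact: measurable_hfun.
  - exact: measurable_hfun.
  - by move=> w; exact: hfun_ge0.
  - by move=> w; exact: hfun_ge0.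
  - exact: ltW.
  - move=> r r0; rewrite !tailf_hfun//.
    have ur : M < u + r by lra.
    by have [] := HM _ ur.
have Uu : (excess P1 U u <= (a^-1)%:E * excess P1 Z u)%E.
  apply: le_integral_tail.
  - exact: measurable_hfun.
  - exact: measurable_hfun.
  - by move=> w; exact: hfun_ge0.
  - by move=> w; exact: hfun_ge0.
  - by rewrite invr_ge0 ltW.
  - move=> r r0; rewrite !tailf_hfun// -ler_pdivrMl ?invr_gt0// invrK.
    have ur : M < u + r by lra.
    by have [] := HM _ ur.
have b0 : 0 < a' / a by rewrite divr_gt0.
have D0 : 0 < (l - 1) * u by rewrite mulr_gt0//; lra.
have Ub : (excess P1 U u <= (a' / a * ((l - 1) * u * G u / k2))%:E)%E.
  apply: (le_trans Uu); apply: (@le_trans _ _ ((a^-1)%:E * (a'%:E * excess P2 V u))%E).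
    apply: lee_wpmul2l; first by rewrite lee_fin invr_ge0 ltW.
    exact: le_trans (ZW u u3) Wu.
  rewrite muleA -EFinM [a^-1 * a']mulrC [leRHS]EFinM; apply: lee_wpmul2l => //.
  by rewrite lee_fin ltW.
(* Finiteness of the excess of [U] is inherited, through [Z] and [W], from the Karamata upper bound
   for [V]. *)
have [e eE] : exists e : R, excess P1 U u = e%:E.
  exists (fine (excess P1 U u)); rewrite fineK// ge0_fin_numE ?excess_ge0//.
  by rewrite (le_lt_trans Ub)// ltry.
move: Ub; rewrite eE lee_fin => eb.
have dm0 : 0 < m - dl by lra.
have eU : (l - 1) * u * (m - dl) * F u <= (1 - l * (m - dl)) * e.
  apply: excess_karamata_lb => // t ut.
  by have [] := HM t (lt_le_trans u1 ut).
have k1E : 1 - l * (m - dl) = k1 by rewrite /k1; ring.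
have k10 : 0 < k1 by rewrite /k1 addr_gt0 ?mulr_gt0.
rewrite k1E in eU.
have Gu := G0 u.
have h1 : (l - 1) * u * (m - dl) * ((1 - dl) * G u) <=
    k1 * (a' / a * ((l - 1) * u * G u / k2)).
  apply: (@le_trans _ _ ((l - 1) * u * (m - dl) * F u)).
    by rewrite ler_wpM2l// ltW// mulr_gt0.
  by apply: (le_trans eU); rewrite ler_pM2l.
have : a * (1 - dl) * (m - dl) * k2 <= a' * k1.
  have DG : 0 < (l - 1) * u * G u by rewrite mulr_gt0.
  rewrite -(ler_pM2r DG).
  have e1 : k1 * (a' / a * ((l - 1) * u * G u / k2)) * (a * k2) =
      a' * k1 * ((l - 1) * u * G u).
    by field; rewrite !gt_eqF.
  have ak : 0 < a * k2 by rewrite mulr_gt0.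
  rewrite -e1.
  have -> : a * (1 - dl) * (m - dl) * k2 * ((l - 1) * u * G u) =
      (l - 1) * u * (m - dl) * ((1 - dl) * G u) * (a * k2) by ring.
  by rewrite ler_pM2r.
by rewrite leNgt contra.
Unshelve. all: by end_near. Qed.

End order.

(** * Truncated means *)

Section truncated_mean.
Variables (d : measure_display) (T : measurableType d) (R : realType).
Variable P : probability T R.
Implicit Types (V : T -> R) (u l m t : R).

Definition tmean V u : \bar R := (\int[P]_w (Num.min (V w) u)%:E)%E.

Lemma measurable_min V u : measurable_fun setT V ->
  measurable_fun setT (fun w => Num.min (V w) u).
Proof. by move=> mV; apply: measurable_minr => //; exact: measurable_cst. Qed.

Lemma tmean_ge0 V u : (forall w, 0 <= V w) -> 0 <= u -> (0 <= tmean V u)%E.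
Proof. by move=> V0 u0; apply: integral_ge0 => w _; rewrite lee_fin le_min V0. Qed.

Lemma tmean_le V u : measurable_fun setT V -> (forall w, 0 <= V w) -> 0 <= u ->
  (tmean V u <= u%:E)%E.
Proof.
move=> mV V0 u0.
rewrite -[leRHS]mule1 -(@probability_setT _ _ _ P) -(integral_cst P measurableT).
apply: ge0_le_integral; first exact: measurableT.
- by move=> w _; rewrite lee_fin le_min V0.
- by apply/measurable_EFinP; exact: measurable_min.
- exact: measurable_cst.
- by move=> w _; rewrite lee_fin ge_min lexx orbT.
Qed.

Lemma tmean_fin V u : measurable_fun setT V -> (forall w, 0 <= V w) -> 0 <= u ->
  exists e : R, tmean V u = e%:E.
Proof.
move=> mV V0 u0; exists (fine (tmean V u)); rewrite fineK// ge0_fin_numE ?tmean_ge0//.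
by rewrite (le_lt_trans (tmean_le mV V0 u0))// ltry.
Qed.

(** Tails are comparable only beyond some threshold [t]; the part of the mean below it costs at most
    [t], uniformly in [u]. *)
Lemma tmean_le_excess V u t : measurable_fun setT V -> (forall w, 0 <= V w) ->
  0 <= u -> 0 <= t ->
  (tmean V u <= t%:E + excess P (fun w => Num.min (V w) u) t)%E.
Proof.
move=> mV V0 u0 t0; have mVu := measurable_min u mV.
have -> : (t%:E = \int[P]_w (cst t%:E) w)%E.
  by rewrite -[LHS]mule1 -(@probability_setT _ _ _ P) -(integral_cst P measurableT).
rewrite /excess -ge0_integralD//.
- apply: ge0_le_integral; first exact: measurableT.
  + by move=> w _; rewrite lee_fin le_min V0.
  + by apply/measurable_EFinP.
  + apply: emeasurable_funD; first exact: measurable_cst.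
    by apply/measurable_EFinP; exact: measurable_hfun.
  + move=> w _; rewrite /= -EFinD lee_fin /hfun /pospart -lerBlDl le_max.
    by rewrite lexx.
- by move=> w _; rewrite lee_fin hfun_ge0.
- by apply/measurable_EFinP; exact: measurable_hfun.
Qed.

Lemma tmean_double V u : measurable_fun setT V -> (forall w, 0 <= V w) -> 0 < u ->
  (tmean V u + (u * tailf P V (2 * u))%:E <= tmean V (2 * u))%E.
Proof.
move=> mV V0 u0; rewrite EFinM -tailfE// /tmean -ge0_integralD_indic//; last 4 first.
- exact: measurable_min.
- by move=> w; rewrite le_min V0 ltW.
- exact: ltW.
- exact: measurable_gt_fun.
apply: ge0_le_integral; first exact: measurableT.
- by move=> w _; rewrite lee_fin addr_ge0 ?le_min ?V0 ?(ltW u0)// mulr_ge0// ltW.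
- apply/measurable_EFinP; apply: measurable_funD; first exact: measurable_min.
  apply: measurable_funM; first exact: measurable_cst.
  by apply: measurable_indic; exact: measurable_gt_fun.
- by apply/measurable_EFinP; exact: measurable_min.
- move=> w _; rewrite lee_fin; have [h|h] := leP (V w) (2 * u).
    rewrite indic_notin /=; last by apply/negP; rewrite -leNgt.
    by rewrite mulr0 addr0 ge_min lexx.
  rewrite (@indic_in _ _ [set w | 2 * u < V w])// mulr1 min_r; lra.
Qed.

Lemma tmean_unbounded V (alpha C : R) : measurable_fun setT V ->
  (forall w, 0 <= V w) -> 0 < alpha -> alpha < 1 -> (forall t, 0 < tailf P V t) ->
  (forall l, 0 < l ->
    tailf P V (l * t) / tailf P V t @[t --> +oo] --> l `^ (- alpha)) ->
  \forall u \near +oo, (C%:E < tmean V u)%E.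
Proof.
move=> mV V0 a0 a1 G0 Greg.
(* As [alpha < 1], doubling a large argument at worst halves the tail, so [t * tailf P V t] does not
   decrease along [t = 2 ^ k * u0]. *)
have h2 : 2^-1 < 2 `^ (- alpha) :> R.
  rewrite powRN ltf_pV2 ?posrE ?powR_gt0//.
  rewrite -[X in _ < X]powRr1// /powR pnatr_eq0/= ltr_expR ltr_pM2r//.
  by rewrite ln_gt0// ltr1n.
have l20 : 0 < 2 :> R by [].
have [M HM] := near_pinfty_gtP (regular_near_lb G0 Greg l20 h2).
pose u0 := Num.max 1 (M + 1).
have u00 : 0 < u0 by rewrite lt_max ltr01.
have u0M t : u0 <= t -> M < t by rewrite ge_max => /andP[_]; apply: lt_le_trans; rewrite ltrDl.
pose b := u0 * tailf P V u0.
have b0 : 0 < b by rewrite mulr_gt0.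
have pow k : u0 <= 2 ^+ k * u0.
  by rewrite ler_peMl ?(ltW u00)// exprn_ege1// ler1n.
have tb k : b <= 2 ^+ k * u0 * tailf P V (2 ^+ k * u0).
  elim: k => [|k IH]; first by rewrite expr0 mul1r.
  apply: (le_trans IH); have := HM (2 ^+ k * u0) (u0M _ (pow k)).
  have u1 : 0 < 2 ^+ k * u0 by rewrite mulr_gt0// exprn_gt0.
  rewrite exprS -[2 * _ * u0]mulrA; move: (2 ^+ k * u0) u1 => v v0.
  move: (tailf _ _ (2 * v)) (tailf _ _ v) => B A; rewrite -(ler_pM2l v0); lra.
(* Each doubling of [u] adds at least [u * tailf P V (2 * u)], half of a quantity bounded below by
   [b]. *)
have grow k : ((k%:R * (b / 2))%:E <= tmean V (2 ^+ k * u0))%E.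
  elim: k => [|k IH].
    by rewrite mul0r tmean_ge0// mulr_ge0// ltW.
  have u1 : 0 < 2 ^+ k * u0 by rewrite mulr_gt0// exprn_gt0.
  rewrite exprS -mulrA; apply: le_trans (tmean_double mV V0 u1).
  rewrite -natr1 mulrDl EFinD; apply: leeD IH _; rewrite mul1r lee_fin.
  have := tb k.+1; rewrite exprS -[2 * _ * u0]mulrA.
  by move: (2 ^+ k * u0) (tailf _ _ _) => v B; lra.
pose k := (Num.truncn (C / (b / 2))).+1.
have kC : C < k%:R * (b / 2).
  by rewrite -ltr_pdivrMr ?divr_gt0// truncnS_gt.
near=> u; apply: (@lt_le_trans _ _ (tmean V (2 ^+ k * u0))).
  by apply: lt_le_trans (grow k); rewrite lte_fin.
have uk : 2 ^+ k * u0 <= u by near: u; apply: nbhs_pinfty_ge; exact: num_real.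
apply: ge0_le_integral; first exact: measurableT.
- by move=> w _; rewrite lee_fin le_min V0 (le_trans (ltW u00)).
- by apply/measurable_EFinP; exact: measurable_min.
- by apply/measurable_EFinP; exact: measurable_min.
- by move=> w _; rewrite lee_fin le_min !ge_min lexx uk orbT.
Unshelve. all: by end_near. Qed.

End truncated_mean.

Lemma tailf_pospart d (T : measurableType d) (R : realType) (P : probability T R)
    (Z : T -> R) (t : R) : 0 <= t -> tailf P (fun w => pospart (Z w)) t = tailf P Z t.
Proof.
move=> t0; congr (fine (P _)); apply/seteqP; split=> w /=; rewrite lt_max.
  by move=> /orP[]// ; lra.
by move=> ->.
Qed.

Section order.
Variables (R : realType) (d1 d2 : measure_display).
Variables (T1 : measurableType d1) (T2 : measurableType d2).
Variables (P1 : probability T1 R) (P2 : probability T2 R).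
Variables (U Z : T1 -> R) (V W : T2 -> R) (alpha cX cY : R).
Hypotheses (mU : measurable_fun setT U) (mZ : measurable_fun setT Z).
Hypotheses (mV : measurable_fun setT V) (mW : measurable_fun setT W).
Hypotheses (V0 : forall w, 0 <= V w).
Let F := tailf P1 U.
Let G := tailf P2 V.
Hypotheses (F0 : forall t, 0 < F t) (G0 : forall t, 0 < G t).
Hypothesis Greg : forall l, 0 < l -> G (l * t) / G t @[t --> +oo] --> l `^ (- alpha).
Hypotheses (ZF : tailf P1 Z t / F t @[t --> +oo] --> cX).
Hypotheses (WG : tailf P2 W t / G t @[t --> +oo] --> cY).

Let Zp w := pospart (Z w).
Let Wp w := pospart (W w).

Lemma tmean_order (u0 : R) : 0 < alpha -> alpha < 1 ->
  (forall eta, 1 < eta -> \forall t \near +oo, F t <= eta * G t) ->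
  (forall u, u0 <= u -> (tmean P2 Wp u <= tmean P1 Zp u)%E) ->
  cY <= cX.
Proof.
move=> al0 al1 FG WZ; rewrite leNgt; apply/negP => cXY.
have cX0 : 0 <= cX.
  rewrite -(cvg_lim (@Rhausdorff R) ZF); apply: limr_ge; first by apply/cvg_ex; exists cX.
  by apply: nearW => t; rewrite divr_ge0 ?tailf_ge0.
have [a [a' [cXa aa' a'cY]]] : exists a, exists a', [/\ cX < a, a < a' & a' < cY].
  exists (cX + (cY - cX) / 3), (cY - (cY - cX) / 3); split; lra.
have a0 : 0 < a by lra.
have a'0 : 0 < a' by lra.
have [eta eta1 aeta] : exists2 eta, 1 < eta & a * eta < a'.
  exists ((a + a') / (2 * a)); first by rewrite ltr_pdivlMr; lra.
  by rewrite mulrA ltr_pdivrMr; nra.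
have near3 : \forall t \near +oo, [/\ tailf P1 Z t <= a * F t,
    a' * G t <= tailf P2 W t & F t <= eta * G t].
  have h1 := ratio_near_ub F0 ZF cXa.
  have h2 := ratio_near_lb G0 WG a'cY.
  have h3 := FG _ eta1.
  by near=> t; split; near: t.
have [M HM] := near_pinfty_gtP near3.
pose t0 := Num.max 1 (M + 1).
have t00 : 0 < t0 by rewrite lt_max ltr01.
have t0M : M < t0 by rewrite lt_max ltrDl ltr01 orbT.
move: t0 t00 t0M => t0 t00 t0M.
have pos0 (z : R) : 0 <= pospart z by rewrite le_max lexx orbT.
have mp d (T : measurableType d) (Y : T -> R) : measurable_fun setT Y ->
    measurable_fun setT (fun w => pospart (Y w)).
  by move=> mY; apply: measurable_maxr => //; exact: measurable_cst.
(* The estimates below combine to [e <= t0 + (t0 + a * eta * e) / a'] for the truncated mean [e] of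
   [V]; as [a * eta < a'], solving for [e] gives [e <= C]. *)
pose C := (t0 + t0 / a') / (1 - a * eta / a').
near (pinfty_nbhs R) => u.
have uu0 : u0 <= u by near: u; apply: nbhs_pinfty_ge; exact: num_real.
have u0' : 0 <= u by near: u; apply: nbhs_pinfty_ge; exact: num_real.
have [e eE] := tmean_fin P2 mV V0 u0'.
have Ce : C < e.
  rewrite -lte_fin -eE; near: u.
  exact: (tmean_unbounded C mV V0 al0 al1 G0 Greg).
have hV := tmean_le_excess P2 mV V0 u0' (ltW t00).
have hZ := tmean_le_excess P1 (mp _ _ _ mZ) (fun w => pos0 (Z w)) u0' (ltW t00).
have min_ge0 (z : R) : 0 <= z -> 0 <= Num.min z u by move=> z0; rewrite le_min z0.
have V2 : (excess P2 (fun w => Num.min (V w) u) t0 <= (a'^-1)%:E * tmean P2 Wp u)%E.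
  apply: le_integral_tail.
  - by apply: measurable_hfun; exact: measurable_min.
  - by apply: measurable_min; exact: (mp _ _ _ mW).
  - by move=> w; exact: hfun_ge0.
  - by move=> w; apply: min_ge0; exact: pos0.
  - by rewrite invr_ge0 ltW.
  move=> r r0; rewrite tailf_hfun// !tailf_min -ler_pdivrMl ?invr_gt0// invrK.
  (* If [t0 + r >= u], truncation makes the tail of [V] vanish. Otherwise [r < u] as well, and
     monotonicity of the tail of [W] absorbs the shift from [t0 + r] to [r]. *)
  case: ifPn => tu; last by rewrite mulr0; case: ifP => _; rewrite ?tailf_ge0.
  have ru : r < u by lra.
  have tr : M < t0 + r by lra.
  rewrite ru tailf_pospart//; have [_ h _] := HM _ tr; apply: (le_trans h).
  rewrite -lee_fin -!tailfE// le_measure ?inE//; try exact: measurable_gt_fun.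
  by move=> w /=; apply: le_lt_trans; lra.
have Z2 : (excess P1 (fun w => Num.min (Zp w) u) t0 <= (a * eta)%:E * tmean P2 V u)%E.
  apply: le_integral_tail.
  - by apply: measurable_hfun; apply: measurable_min; exact: (mp _ _ _ mZ).
  - exact: measurable_min.
  - by move=> w; exact: hfun_ge0.
  - by move=> w; exact: min_ge0.
  - by rewrite mulr_ge0; lra.
  move=> r r0; rewrite tailf_hfun// !tailf_min.
  have aeta0 : 0 <= a * eta by rewrite mulr_ge0 ?(ltW a0)//; lra.
  case: ifPn => tu; last by rewrite mulr_ge0//; case: ifP => _; rewrite ?tailf_ge0.
  have ru : r < u by lra.
  have tr : M < t0 + r by lra.
  rewrite ru tailf_pospart; last lra.
  have [h1 _ h2] := HM _ tr; apply: (le_trans h1).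
  apply: (@le_trans _ _ (a * (eta * G (t0 + r)))); first by rewrite ler_pM2l.
  rewrite mulrA ler_wpM2l//.
  rewrite -lee_fin -!tailfE// le_measure ?inE//; try exact: measurable_gt_fun.
  by move=> w /=; apply: le_lt_trans; lra.
have : (e%:E <= (t0 + a'^-1 * (t0 + a * eta * e))%:E)%E.
  change (e%:E <= t0%:E + (a'^-1)%:E * (t0%:E + (a * eta)%:E * e%:E))%E.
  rewrite -eE; apply: (le_trans hV); apply: leeD => //; apply: (le_trans V2).
  apply: lee_wpmul2l; first by rewrite lee_fin invr_ge0 ltW.
  by apply: (le_trans (WZ u uu0)); apply: (le_trans hZ); apply: leeD.
rewrite lee_fin.
have d0 : 0 < 1 - a * eta / a' by rewrite subr_gt0 ltr_pdivrMr// mul1r.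
move: Ce; rewrite /C ltr_pdivrMr// mulrDr => h1.
have -> : t0 + a'^-1 * (t0 + a * eta * e) = t0 + t0 / a' + e * (a * eta / a') by ring.
by move=> h2; move: h1; rewrite mulr1 mulrN; move: (e * _) (t0 / a') h2 => x y; lra.
Unshelve. all: by end_near. Qed.

End order.

(** * From limsup hypotheses to tail inequalities, and the theorem *)

Lemma not_near_tail_lt (R : realType) (d1 d2 : measure_display)
    (T1 : measurableType d1) (T2 : measurableType d2)
    (P1 : probability T1 R) (P2 : probability T2 R)
    (U : T1 -> R) (V : T2 -> R) (eta : R) :
  measurable_fun setT U -> measurable_fun setT V -> (forall t, 0 < tailf P2 V t) ->
  limf_esup (fun t : R => tail_ratio (P1 [set w | t < U w]) (P2 [set w | t < V w]))
    (pinfty_nbhs R) = 1%E ->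
  eta < 1 -> ~ \forall t \near +oo, tailf P1 U t < eta * tailf P2 V t.
Proof.
move=> mU mV G0 lim1 eta1 near_lt.
have : (1 <= eta%:E)%E.
  rewrite -lim1; apply: near_limf_esup_le; apply: filterS near_lt => t h.
  rewrite /tail_ratio !tailfE// eqe gt_eqF// lee_fin /=.
  by rewrite ler_pdivrMr// ltW.
by rewrite lee_fin leNgt eta1.
Qed.

(** The portfolio loss order has the closed tail [P(V >= t)] in its denominator. For [l < 1] it is
    at most the open tail at [l * t], which by regular variation exceeds the open tail at [t] by a
    factor close to 1 when [l] is. *)
Lemma aplR_near_tail_le (R : realType) (d1 d2 : measure_display)
    (T1 : measurableType d1) (T2 : measurableType d2)
    (P1 : probability T1 R) (P2 : probability T2 R)
    (U : T1 -> R) (V : T2 -> R) (alpha eta : R) :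
  measurable_fun setT U -> measurable_fun setT V -> (forall t, 0 < tailf P2 V t) ->
  0 < alpha ->
  (forall l, 0 < l ->
    tailf P2 V (l * t) / tailf P2 V t @[t --> +oo] --> l `^ (- alpha)) ->
  aplR P1 P2 U V -> 1 < eta ->
  \forall t \near +oo, tailf P1 U t <= eta * tailf P2 V t.
Proof.
move=> mU mV G0 a0 Greg UV eta1.
(* The margin [eta] is shared: [eta'] for the limsup and [eta / eta'] for passing from the closed to
   the open tail; [y] lies strictly between 1 and the latter and fixes [l]. *)
pose eta' := (1 + eta) / 2; pose y := (1 + eta / eta') / 2.
have eta'1 : 1 < eta' by rewrite /eta'; lra.
have eta'0 : 0 < eta' by lra.
have ey : 1 < eta / eta' by rewrite ltr_pdivlMr// /eta'; lra.
have y1 : 1 < y by move: ey; rewrite /y; move: (eta / eta') => z; lra.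
have ye : y < eta / eta' by move: ey; rewrite /y; move: (eta / eta') => z; lra.
pose l := y `^ (- alpha)^-1.
have y0 : 0 < y by lra.
have l0 : 0 < l by rewrite powR_gt0.
have lE : l `^ (- alpha) = y by rewrite powRKV ?(ltW y0)// oppr_eq0 gt_eqF.
have l1 : l < 1.
  rewrite /l invrN powRN invf_lt1 ?powR_gt0//.
  suff : 1 `^ alpha^-1 < y `^ alpha^-1 by rewrite powR1.
  apply: gt0_ltr_powR => //; rewrite ?invr_gt0 ?nnegrE//.
  exact: ltW.
have xi1 : simplex (const_mx 1 : 'rV[R]_1).
  by split=> [i|]; rewrite ?big_ord1 mxE.
have dE (z : R) : dotv (const_mx 1 : 'rV[R]_1) (const_mx z) = z.
  by rewrite /dotv big_ord1 !mxE mul1r.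
have lim1 := UV _ xi1.
have : (limf_esup (fun t : R => tail_ratio (P1 [set w | (t < U w)%R])
    (P2 [set w | (t <= V w)%R])) (pinfty_nbhs R) < eta'%:E)%E.
  apply: (@le_lt_trans _ _ 1%:E%E); last by rewrite lte_fin.
  apply: le_trans lim1; rewrite le_eqVlt; apply/orP; left; apply/eqP.
  congr limf_esup; apply/funext => t; congr (tail_ratio (P1 _) (P2 _));
    by apply/funext => w /=; rewrite dE.
move=> /limf_esup_lt_near near1.
have near2 : \forall t \near +oo, tailf P2 V (l * t) <= eta / eta' * tailf P2 V t.
  by apply: (regular_near_ub G0 Greg) => //; rewrite lE.
have near3 : \forall t \near +oo, (0 : R) < t by apply: nbhs_pinfty_gt; exact: num_real.
near=> t.
have t0 : 0 < t by near: t.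
have mVt : measurable [set w | t <= V w] by exact: measurable_le_fun.
have QE : P2 [set w | t <= V w] = (fine (P2 [set w | t <= V w]))%:E.
  by rewrite fineK// fin_num_measure.
have Q1 : tailf P2 V t <= fine (P2 [set w | t <= V w]).
  rewrite -lee_fin -QE -tailfE// le_measure ?inE//; first exact: measurable_gt_fun.
  by move=> w /= /ltW.
have Q2 : fine (P2 [set w | t <= V w]) <= tailf P2 V (l * t).
  rewrite -lee_fin -QE -tailfE// le_measure ?inE//; first exact: measurable_gt_fun.
  by move=> w /=; apply: lt_le_trans; rewrite gtr_pMl.
have h2 : tailf P2 V (l * t) <= eta / eta' * tailf P2 V t by near: t.
have : (tail_ratio (P1 [set w | (t < U w)%R]) (P2 [set w | (t <= V w)%R]) < eta'%:E)%E.
  by near: t.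
have Q0 : 0 < fine (P2 [set w | t <= V w]) by exact: lt_le_trans Q1.
rewrite /tail_ratio QE eqe gt_eqF// lte_fin /= -/(tailf P1 U t) ltr_pdivrMr// => h1.
apply: (le_trans (ltW h1)).
have -> : eta * tailf P2 V t = eta' * (eta / eta' * tailf P2 V t).
  by rewrite mulrA [eta' * _]mulrC divfK// gt_eqF.
by rewrite ler_pM2l// (le_trans Q2).
Unshelve. all: by end_near. Qed.

Lemma expectation_floss (R : realType) (d : measure_display) (T : measurableType d)
    (P : probability T R) (Z : T -> R) (u : R) : 0 <= u ->
  ('E_P[fun w => floss u (pospart (Z w))] = - tmean P (fun w => pospart (Z w)) u)%E.
Proof.
move=> u0; rewrite unlock /tmean -integral_ge0N//.
by move=> w _; rewrite lee_fin le_min u0 le_max lexx orbT.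
Qed.

Theorem theorem4p1 (R : realType) (n : nat)
    (d1 d2 : measure_display)
    (T1 : measurableType d1) (T2 : measurableType d2)
    (P1 : probability T1 R) (P2 : probability T2 R)
    (X : {RV P1 >-> borel_rV R n.+1}) (Y : {RV P2 >-> borel_rV R n.+1})
    (alpha : R)
    (PsiX PsiY : {finite_measure set (borel_rV R n.+1) -> \bar R})
    (alpha_gt0 : 0 < alpha) (alpha_neq1 : alpha <> 1)
    (mrvX : mrv P1 alpha X) (mrvY : mrv P2 alpha Y)
    (specX : canonical_spectral P1 alpha X PsiX)
    (specY : canonical_spectral P2 alpha Y PsiY)
    (balX : balanced_tails P1 X) (balY : balanced_tails P2 Y) :
  (1 < alpha ->
   limf_esup (fun t : R => tail_ratio
       (P1 [set w | t < `|(X w : 'rV[R]_n.+1) ord0 ord0|])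
       (P2 [set w | t < `|(Y w : 'rV[R]_n.+1) ord0 ord0|]))
     (pinfty_nbhs R) = 1%E ->
   (exists2 u0 : R, 0 < u0 &
     forall u : R, u0 <= u -> forall xi : 'rV[R]_n.+1, simplex xi ->
       ('E_P1[fun w => hfun u (dotv xi (X w))]
        <= 'E_P2[fun w => hfun u (dotv xi (Y w))])%E) ->
   leG alpha PsiX PsiY)
  /\
  (alpha < 1 ->
   aplR P1 P2 (fun w => `|(X w : 'rV[R]_n.+1) ord0 ord0|)
              (fun w => `|(Y w : 'rV[R]_n.+1) ord0 ord0|) ->
   aplR P2 P1 (fun w => `|(Y w : 'rV[R]_n.+1) ord0 ord0|)
              (fun w => `|(X w : 'rV[R]_n.+1) ord0 ord0|) ->
   (exists2 u0 : R, 0 < u0 &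
     forall u : R, u0 <= u -> forall xi : 'rV[R]_n.+1, simplex xi ->
       ('E_P1[fun w => floss u (pospart (dotv xi (X w)))]
        <= 'E_P2[fun w => floss u (pospart (dotv xi (Y w)))])%E) ->
   leG alpha PsiY PsiX).
Proof.
have mX : measurable_fun setT (X : T1 -> borel_rV R n.+1) by exact: measurable_funPT.
have mY : measurable_fun setT (Y : T2 -> borel_rV R n.+1) by exact: measurable_funPT.
have mabs d (T : measurableType d) (Z : T -> borel_rV R n.+1) :
    measurable_fun setT Z ->
    measurable_fun setT (fun w => `|(Z w : 'rV[R]_n.+1) ord0 ord0|).
  apply: (@measurableT_comp _ _ _ _ (borel_rV R n.+1) _
    (fun x : 'rV[R]_n.+1 => `|x ord0 ord0|) _ Z).
  apply: continuous_measurable_borelR => x.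
  exact: (cvg_norm (@continuous_coord _ _ _ ord0 ord0 x)).
have mdot d (T : measurableType d) (Z : T -> borel_rV R n.+1) (xi : 'rV[R]_n.+1) :
    measurable_fun setT Z -> measurable_fun setT (fun w => dotv xi (Z w)).
  apply: (@measurableT_comp _ _ _ _ (borel_rV R n.+1) _ (dotv xi) _ Z).
  by apply: continuous_measurable_borelR; exact: continuous_dotv.
have [F0 Freg Fdot] := portfolio_tail alpha_gt0 mX specX balX.
have [G0 Greg Gdot] := portfolio_tail alpha_gt0 mY specY balY.
have mU := mabs _ _ _ mX; have mV := mabs _ _ _ mY.
split=> [alpha1 lim1 [u0 u00 hu] xi sxi|alpha1 XY _ [u0 u00 hu] xi sxi].
  have [cX -> ZF] := Fdot xi; have [cY -> WG] := Gdot xi.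
  rewrite lee_fin; apply: (excess_order mU
    (mdot _ _ _ xi mX) mV (mdot _ _ _ xi mY) F0 G0 Greg ZF WG (u0 := u0) alpha1 Freg).
    by move=> eta; exact: not_near_tail_lt.
  by move=> u uu0; have := hu u uu0 xi sxi; rewrite unlock.
have [cX -> ZF] := Fdot xi; have [cY -> WG] := Gdot xi.
rewrite lee_fin; apply: (tmean_order (mdot _ _ _ xi mX) mV (mdot _ _ _ xi mY)
  (fun w => normr_ge0 _) F0 G0 Greg ZF WG alpha_gt0 alpha1 (u0 := u0)).
  by move=> eta; exact: (aplR_near_tail_le mU mV G0 alpha_gt0 Greg XY).
(* The sign in [floss] turns the hypothesis into an inequality from [Y] to [X] between truncated
   means, which is why the conclusion is reversed. *)
move=> u uu0; have u0' : 0 <= u := le_trans (ltW u00) uu0.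
by have := hu u uu0 xi sxi; rewrite !expectation_floss// leeN2.
Qed.
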